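(* Let $(\varphi,\psi)$ be a pair of kernels with $M_0(\psi)<+\infty$. For every $f\in L^p(\mathbb{R})$, $1\le p<+\infty$, $$\lim_{w\to+\infty}\lVert S_w^{\varphi,\psi}f-f\rVert_p=0.$$
   Context: For $g:\mathbb{R}\to\mathbb{R}$ and $\nu\ge 0$ put $$M_\nu(g):=\sup_{u\in\mathbb{R}}\sum_{k\in\mathbb{Z}}|g(u-k)|\,|u-k|^\nu,$$ so that $M_0(g)=\sup_{u}\sum_{k}|g(u-k)|$. A pair of kernels $(\varphi,\psi)$ is a pair of functions $\varphi,\psi:\mathbb{R}\to\mathbb{R}$ in $L^1(\mathbb{R})$ such that: $\varphi$ is bounded in a neighborhood of the origin; $\sum_{k\in\mathbb{Z}}\varphi(u-k)=1$ for every $u\in\mathbb{R}$; $\int_{\mathbb{R}}\psi(u)\,du=1$; and there exists $r>0$ with $M_r(\varphi)<+\infty$. The Durrmeyer sampling operators are, for $w>0$ and any $f$ for which the series converges for every $x$, $$(S_w^{\varphi,\psi}f)(x)=\sum_{k\in\mathbb{Z}}\varphi(wx-k)\,w\int_{\mathbb{R}}\psi(wu-k)f(u)\,du,\qquad x\in\mathbb{R}.$$ *)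

(* Defs.v *)
From HB Require Import structures.
From mathcomp Require Import all_boot all_order all_algebra.
From mathcomp Require Import all_classical all_reals all_analysis.

Set Implicit Arguments.
Unset Strict Implicit.
Unset Printing Implicit Defensive.

Import Order.TTheory GRing.Theory Num.Theory.
Import numFieldNormedType.Exports.

Local Open Scope classical_set_scope.
Local Open Scope ring_scope.

(* Lebesgue measure on the sigma-algebra of all Lebesgue-measurable sets
   ([lebesgue_measure] is its restriction to the Borel sets). *)
Notation leb R := (@completed_lebesgue_measure R).

Section durrmeyer.
Context {R : realType}.
Implicit Types (g phi psi f : R -> R) (a : int -> R) (w nu : R).

(* A series over Z converges when its two halves, k >= 0 and k < 0, do;
   [Negz n] is [- n.+1]. *)
Definition is_cvg_sumZ a : Prop :=
  cvgn (series (fun n : nat => a (Posz n))) /\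
  cvgn (series (fun n : nat => a (Negz n))).

Definition sumZ a : R :=
  limn (series (fun n : nat => a (Posz n))) +
  limn (series (fun n : nat => a (Negz n))).

(* As [0 `^ 0 = 1], the weight is identically 1 when [nu = 0]. *)
Definition moment nu g : \bar R :=
  ereal_sup [set (\esum_(k in [set: int])
      (`|g (u - k%:~R)| * `|u - k%:~R| `^ nu)%:E)%E | u in [set: R]].

Record kernel_pair phi psi : Prop := KernelPair {
  kernel_Lfun1_phi : phi \in Lfun (leb R) 1;
  kernel_Lfun1_psi : psi \in Lfun (leb R) 1;
  kernel_bounded : bounded_near phi (nbhs (0 : R));
  kernel_partition : forall u : R,
    is_cvg_sumZ (fun k => phi (u - k%:~R)) /\
    sumZ (fun k => phi (u - k%:~R)) = 1;
  kernel_integral : \int[leb R]_u psi u = 1;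
  kernel_moment : exists2 r : R, 0 < r & (moment r phi < +oo)%E
}.

Definition durrmeyer_term phi psi w f (x : R) (k : int) : R :=
  phi (w * x - k%:~R) *
  (w * \int[leb R]_u (psi (w * (u : R) - k%:~R) * f u)).

(* The domain of the operator: the integrals make sense and the series
   converges at every point. *)
Definition durrmeyer_defined phi psi w f : Prop :=
  (forall k : int, (leb R).-integrable [set: R]
     (fun u => (psi (w * (u : R) - k%:~R) * f u)%:E)) /\
  (forall x : R, is_cvg_sumZ (durrmeyer_term phi psi w f x)).

Definition durrmeyer phi psi w f (x : R) : R :=
  sumZ (durrmeyer_term phi psi w f x).

End durrmeyer.

(* Main.v *)
Require Import Defs.
From HB Require Import structures.
From mathcomp Require Import all_boot all_order all_algebra.
From mathcomp Require Import all_classical all_reals all_analysis.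
From mathcomp Require Import measurable_realfun ring lra zify.

(** Everything is controlled by one functional. Put [x = (t + k) / w] and
    [u = (v + k) / w]. Since [phi] is a partition of unity and [psi] has
    integral 1, [S_w f x - f x] is the sum over [k] of [phi (w x - k)] times
    the [psi]-average of [v |-> f ((v + k) / w) - f x]. A substitute for
    Jensen's inequality, with a worse constant ([powR_le_of_le_add]), moves the
    exponent [p] inside this average; integrating in [x] and substituting then
    bounds the integral of [|S_w f - f|^p] by a constant, independent of [w]
    and [f], times

      osc f w = 1/w * sum_k \int |phi t| * \int |psi v| *
                        |f ((v + k) / w) - f ((t + k) / w)|^p dv dt

    ([integral_sampling_series_le]). It remains to show that [osc f w] tends
    to 0 for every [f] in L^p.

    Because the translates of [phi] and of [psi] have uniformly bounded sums,
    [osc f w] is at most a constant times the p-th power of the L^p norm of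
    [f], uniformly in [w] ([osc_le]). As [osc] is also subadditive up to the
    factor [2^p], the functions whose oscillation vanishes in the limit form a
    linear space that is closed in L^p. Such a class contains L^p as soon as
    it contains the indicators of sets of finite measure ([Lp_induction]). A
    set of finite measure is approximated by finite unions of intervals,
    straight from the definition of the Lebesgue outer measure ([lebm_cover],
    [finite_cover_approximation]), and a union oscillates at most as much as
    its two parts together. So only intervals [ ]c, d] ] are left.

    For those one counts: the points [(t + k) / w] and [(v + k) / w] are
    separated by a given end point for at most [|v - t| + 1] integers [k], a
    number that does not grow with [w], while the interval contains at most
    [(d - c) w + 1] of the points [(t + k) / w]. After division by [w] the sum
    over [k] thus tends to 0 for each [(t, v)] and remains bounded, and
    integrability of [phi] and [psi] concludes ([vanishing_count]).

    Except for the approximation by intervals and the counting, the argument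
    uses nothing of the line but a family of measurable maps [node w k], here
    [x |-> (x + k) / w], that scale the measure and have measurable inverses;
    that part is carried out over an abstract measure space. *)

Set Implicit Arguments.
Unset Strict Implicit.
Unset Printing Implicit Defensive.

Import Order.TTheory GRing.Theory Num.Theory.
Import numFieldNormedType.Exports.

Local Open Scope classical_set_scope.
Local Open Scope ring_scope.

(** * Series indexed by the integers *)
Section sumZ.
Local Open Scope ereal_scope.
Context {R : realType}.
Implicit Types (a : int -> \bar R).

Lemma esum_int a : (forall k, 0 <= a k) ->
  \esum_(k in [set: int]) a k =
  \sum_(n <oo) a (Posz n) + \sum_(n <oo) a (Negz n).
Proof.
move=> a0; rewrite (esumID (range Posz)) ?setTI; last by move=> ? _; exact: a0.
have -> : ~` range Posz = range Negz.
  apply/seteqP; split => [[n|n] /=|_ [n _ <-] [m _]//].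
    by move=> []; exists n.
  by move=> _; exists n.
by rewrite !esum_image ?nneseries_esumT//; move=> x y _ _ [].
Qed.

Lemma esumZl a (c : R) : (0 <= c)%R -> (forall k, 0 <= a k) ->
  \esum_(k in [set: int]) (c%:E * a k) = c%:E * \esum_(k in [set: int]) a k.
Proof.
move=> c0 a0; have ca0 k : 0 <= c%:E * a k by rewrite mule_ge0.
rewrite !esum_int// !nneseriesZl// ge0_muleDr// nneseries_ge0//.
Qed.

Lemma ge0_integral_esum_int d (T : measurableType d)
    (mu : {measure set T -> \bar R}) (f : int -> T -> \bar R) :
  (forall k, measurable_fun [set: T] (f k)) -> (forall k x, 0 <= f k x) ->
  \int[mu]_x (\esum_(k in [set: int]) f k x) =
  \esum_(k in [set: int]) \int[mu]_x f k x.
Proof.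
move=> mf f0; rewrite esum_int; last by move=> k; exact: integral_ge0.
under eq_integral do rewrite esum_int//.
rewrite ge0_integralD//=; first by rewrite !integral_nneseries.
- by move=> x _; exact: nneseries_ge0.
- exact: ge0_emeasurable_sum.
- by move=> x _; exact: nneseries_ge0.
- exact: ge0_emeasurable_sum.
Qed.

Lemma measurable_esum_int d (T : measurableType d) (f : int -> T -> \bar R) :
  (forall k, measurable_fun [set: T] (f k)) -> (forall k x, 0 <= f k x) ->
  measurable_fun [set: T] (fun x => \esum_(k in [set: int]) f k x).
Proof.
move=> mf f0; under eq_fun do rewrite esum_int//.
by apply: emeasurable_funD; exact: ge0_emeasurable_sum.
Qed.

Lemma series_abs_le (u : nat -> R) : \sum_(n <oo) `|u n|%:E < +oo ->
  cvgn (series u) /\ `|limn (series u)|%:E <= \sum_(n <oo) `|u n|%:E.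
Proof.
move=> uoo.
have cu : cvgn [normed series u].
  by apply: nnseries_is_cvg => // n; exact: normr_ge0.
split; first exact: normed_cvg.
apply: (@le_trans _ _ (limn [normed series u])%:E).
  by rewrite lee_fin; exact: lim_series_norm.
rewrite -EFin_lim// le_eqVlt; apply/orP; left; apply/eqP; congr (limn _).
by apply/funext => n /=; rewrite /series/= sumEFin.
Qed.

(** The unordered sum of the absolute values controls both halves of the
    series at once: it gives their convergence and bounds the total. *)
Lemma sumZ_abs_le (b : int -> R) : \esum_(k in [set: int]) `|b k|%:E < +oo ->
  is_cvg_sumZ b /\ `|sumZ b|%:E <= \esum_(k in [set: int]) `|b k|%:E.
Proof.
rewrite esum_int// => boo.
have s0 (u : nat -> R) : 0 <= \sum_(n <oo) `|u n|%:E by exact: nneseries_ge0.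
have [|c1 l1] := @series_abs_le (fun n => b (Posz n)).
  by apply: le_lt_trans boo; rewrite leeDl.
have [|c2 l2] := @series_abs_le (fun n => b (Negz n)).
  by apply: le_lt_trans boo; rewrite leeDr.
split; first by split.
rewrite /sumZ; apply: (le_trans _ (leeD l1 l2)).
by rewrite -EFinD lee_fin ler_normD.
Qed.

Lemma sumZB_scale (b c : int -> R) (x : R) : is_cvg_sumZ b -> is_cvg_sumZ c ->
  (sumZ b - x * sumZ c = sumZ (fun k => b k - x * c k))%R.
Proof.
move=> [b1 b2] [c1 c2]; rewrite /sumZ.
have E (u v : nat -> R) : cvgn (series u) -> cvgn (series v) ->
   (limn (series (fun n => u n - x * v n)) =
    limn (series u) - x * limn (series v))%R.
  move=> cu cv; have := lim_seriesB cu (is_cvg_seriesZ (k := x) cv).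
  by rewrite lim_seriesZ.
rewrite !E//; ring.
Qed.
End sumZ.

(** * Weighted double integrals along a family of nodes *)
Section ge0_integral.
Local Open Scope ereal_scope.
(** Immediate from the definition of the integral of a nonnegative function
    as a supremum over the simple functions below it. *)
Lemma le_ge0_integral d (T : measurableType d) (R : realType)
    (mu : {measure set T -> \bar R}) (f g : T -> \bar R) :
  (forall x, 0 <= f x) -> (forall x, f x <= g x) ->
  \int[mu]_x f x <= \int[mu]_x g x.
Proof.
move=> f0 fg; rewrite !ge0_integralTE//; last by move=> x; exact: le_trans (fg x).
by apply: le_ereal_sup => _ [h hf <-]; exists h => // x; exact: le_trans (fg x).
Qed.
End ge0_integral.

(** The maps [pre k] invert the nodes, so that moving the integration to the
    variable [u = node k v] turns the sum over [k] into the sum of the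
    translates of the weight [b], which is bounded by hypothesis. On the line,
    [pre k u = w u - k]. *)
Section dilated_sum.
Local Open Scope ereal_scope.
Context d (T : measurableType d) (R : realType).
Variable mu : {measure set T -> \bar R}.
Variables (node_family pre : int -> T -> T) (b : T -> \bar R) (Mb w : R).
Hypotheses (w0 : (0 < w)%R) (mpre : forall k, measurable_fun [set: T] (pre k)).
Hypothesis preK : forall k, cancel (node_family k) (pre k).
Hypothesis ge0_integral_nodes : forall k (F : T -> \bar R),
  measurable_fun [set: T] F -> (forall x, 0 <= F x) ->
  \int[mu]_x F (node_family k x) = w%:E * \int[mu]_x F x.
Hypotheses (mb : measurable_fun [set: T] b) (b0 : forall x, 0 <= b x).
Hypothesis bM : forall u : T, \esum_(k in [set: int]) b (pre k u) <= Mb%:E.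

Lemma esum_integral_node_le (g : T -> R) :
  measurable_fun [set: T] g -> (forall x, 0 <= g x)%R ->
  \esum_(k in [set: int]) \int[mu]_v (b v * (g (node_family k v))%:E) <=
  (w * Mb)%:E * \int[mu]_u (g u)%:E.
Proof.
move=> mg g0.
pose F (k : int) (u : T) := b (pre k u) * (g u)%:E.
have mF k : measurable_fun [set: T] (F k).
  apply: emeasurable_funM; last exact/measurable_EFinP.
  exact: (measurableT_comp mb (mpre k)).
have F0 k u : 0 <= F k u by rewrite mule_ge0 ?lee_fin.
have FE k : \int[mu]_v (b v * (g (node_family k v))%:E) = w%:E * \int[mu]_u F k u.
  rewrite -(ge0_integral_nodes k)//.
  by apply: eq_integral => v _; rewrite /F preK.
under eq_esum do rewrite FE.
rewrite esumZl ?(ltW w0)//; last by move=> k; exact: integral_ge0.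
rewrite -ge0_integral_esum_int// EFinM -muleA lee_wpmul2l ?lee_fin ?(ltW w0)//.
have Mb0 : (0 <= Mb)%R.
  by rewrite -lee_fin (le_trans _ (bM point))//; apply: esum_ge0.
rewrite -ge0_integralZl_EFin//; last exact/measurable_EFinP; last first.
  by move=> u _; rewrite lee_fin.
apply: le_ge0_integral => u; first by apply: esum_ge0 => k _; exact: F0.
rewrite /F; under eq_esum do rewrite muleC.
rewrite esumZl//.
by rewrite [leRHS]muleC lee_wpmul2l ?lee_fin//; exact: bM.
Qed.
End dilated_sum.

Section energy.
Local Open Scope ereal_scope.
Context d (T : measurableType d) (R : realType).
Variable mu : {sigma_finite_measure set T -> \bar R}.
Variable node : R -> int -> T -> T.
Hypothesis mnode : forall w k, (0 < w)%R -> measurable_fun [set: T] (node w k).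
Variables (a b : T -> \bar R).
Hypotheses (ma : measurable_fun [set: T] a) (a0 : forall x, 0 <= a x).
Hypotheses (mb : measurable_fun [set: T] b) (b0 : forall x, 0 <= b x).

(** The double integral that appears when the p-th power of the error is
    integrated; [H k t v] stands for a function of the two points
    [node w k t] and [node w k v]. Keeping [H] arbitrary reduces each estimate
    of the oscillation to a pointwise inequality between integrands. *)
Definition energy (w : R) (H : int -> T -> T -> R) : \bar R :=
  w^-1%:E * \esum_(k in [set: int])
    \int[mu]_t (a t * \int[mu]_v (b v * (H k t v)%:E)).

Definition jointly_measurable (H : int -> T -> T -> R) :=
  forall k, measurable_fun [set: T * T] (fun z => H k z.1 z.2).

Let inner_ge0 (h : T -> R) : (forall v, 0 <= h v)%R ->
  0 <= \int[mu]_v (b v * (h v)%:E).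
Proof.
by move=> h0; apply: integral_ge0 => v _; rewrite mule_ge0// lee_fin.
Qed.

Let outer_ge0 (h : T -> T -> R) : (forall t v, 0 <= h t v)%R ->
  0 <= \int[mu]_t (a t * \int[mu]_v (b v * (h t v)%:E)).
Proof.
by move=> h0; apply: integral_ge0 => v _; rewrite mule_ge0// inner_ge0.
Qed.

Lemma measurable_section H k t : jointly_measurable H -> measurable_fun [set: T] (H k t).
Proof. by move=> mH; exact: (measurableT_comp (mH k) (pair1_measurable t)). Qed.

Lemma measurable_weighted_section H k t : jointly_measurable H ->
  measurable_fun [set: T] (fun v => b v * (H k t v)%:E).
Proof.
move=> mH; apply: emeasurable_funM => //.
exact/measurable_EFinP/measurable_section.
Qed.

Lemma measurable_inner H k : jointly_measurable H -> (forall t v, 0 <= H k t v)%R ->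
  measurable_fun [set: T] (fun t => \int[mu]_v (b v * (H k t v)%:E)).
Proof.
move=> mH H0.
apply: (@measurable_fun_fubini_tonelli_F _ _ _ _ _ mu
  (fun z => b z.2 * (H k z.1 z.2)%:E)).
- apply: emeasurable_funM; first exact: (measurableT_comp mb measurable_snd).
  exact/measurable_EFinP.
- by move=> z; rewrite mule_ge0 ?lee_fin.
Qed.

Lemma le_energy w H K : (0 < w)%R -> (forall k t v, 0 <= H k t v <= K k t v)%R ->
  energy w H <= energy w K.
Proof.
move=> w0 HK; apply: lee_wpmul2l; first by rewrite lee_fin invr_ge0 ltW.
have H0 k t v : (0 <= H k t v)%R by case/andP: (HK k t v).
apply: le_esum => k _; apply: le_ge0_integral => t.
  by rewrite mule_ge0// inner_ge0.
apply: lee_wpmul2l => //; apply: le_ge0_integral => v.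
  by rewrite mule_ge0// lee_fin.
by apply: lee_wpmul2l => //; rewrite lee_fin; case/andP: (HK k t v).
Qed.

Lemma energyD w H K : (0 < w)%R -> jointly_measurable H -> jointly_measurable K ->
  (forall k t v, 0 <= H k t v)%R -> (forall k t v, 0 <= K k t v)%R ->
  energy w (fun k t v => H k t v + K k t v)%R = energy w H + energy w K.
Proof.
move=> w0 mH mK H0 K0; rewrite /energy -ge0_muleDr; last 2 first.
- by apply: esum_ge0 => k _; exact: outer_ge0.
- by apply: esum_ge0 => k _; exact: outer_ge0.
congr (_ * _); rewrite -esumD; last 2 first.
- by move=> k _; exact: outer_ge0.
- by move=> k _; exact: outer_ge0.
apply: eq_esum => k _; rewrite -ge0_integralD//; last 4 first.
- by move=> t _; rewrite mule_ge0// inner_ge0.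
- by apply: emeasurable_funM => //; exact: measurable_inner.
- by move=> t _; rewrite mule_ge0// inner_ge0.
- by apply: emeasurable_funM => //; exact: measurable_inner.
apply: eq_integral => t _; rewrite -ge0_muleDr ?inner_ge0//; congr (_ * _).
rewrite -ge0_integralD//; last 4 first.
- by move=> v _; rewrite mule_ge0// lee_fin.
- exact: measurable_weighted_section.
- by move=> v _; rewrite mule_ge0// lee_fin.
- exact: measurable_weighted_section.
by apply: eq_integral => v _; rewrite EFinD ge0_muleDr// lee_fin.
Qed.

Lemma energyZ w c H : (0 < w)%R -> (0 <= c)%R -> jointly_measurable H ->
  (forall k t v, 0 <= H k t v)%R ->
  energy w (fun k t v => c * H k t v)%R = c%:E * energy w H.
Proof.
move=> w0 c0 mH H0; rewrite /energy [RHS]muleCA; congr (_ * _).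
rewrite -esumZl//; last by move=> k; exact: outer_ge0.
apply: eq_esum => k _; rewrite -ge0_integralZl_EFin//; last 2 first.
- by move=> t _; rewrite mule_ge0// inner_ge0.
- by apply: emeasurable_funM => //; exact: measurable_inner.
apply: eq_integral => t _; rewrite [RHS]muleCA; congr (_ * _).
rewrite -ge0_integralZl_EFin//; last 2 first.
- by move=> v _; rewrite mule_ge0// lee_fin.
- exact: measurable_weighted_section.
by apply: eq_integral => v _; rewrite EFinM muleCA.
Qed.

Section bounds.
Variables (w Aa Ab Ma Mb : R).
Hypothesis w0 : (0 < w)%R.
Hypotheses (Ma0 : (0 <= Ma)%R) (Mb0 : (0 <= Mb)%R).
Hypotheses (intA : \int[mu]_x a x <= Aa%:E) (intB : \int[mu]_x b x <= Ab%:E).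
Hypothesis a_node : forall g : T -> R, measurable_fun [set: T] g ->
  (forall x, 0 <= g x)%R ->
  \esum_(k in [set: int]) \int[mu]_v (a v * (g (node w k v))%:E) <=
  (w * Ma)%:E * \int[mu]_u (g u)%:E.
Hypothesis b_node : forall g : T -> R, measurable_fun [set: T] g ->
  (forall x, 0 <= g x)%R ->
  \esum_(k in [set: int]) \int[mu]_v (b v * (g (node w k v))%:E) <=
  (w * Mb)%:E * \int[mu]_u (g u)%:E.
Variable g : T -> R.
Hypotheses (mg : measurable_fun [set: T] g) (g0 : forall x, (0 <= g x)%R).

Let Aa0 : (0 <= Aa)%R.
Proof. by rewrite -lee_fin (le_trans _ intA)// integral_ge0. Qed.

Let Ab0 : (0 <= Ab)%R.
Proof. by rewrite -lee_fin (le_trans _ intB)// integral_ge0. Qed.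

Let w_cancel (x y : R) (z : \bar R) : (0 <= x)%R -> (0 <= y)%R -> 0 <= z ->
  w^-1%:E * (x%:E * ((w * y)%:E * z)) = (x * y)%:E * z.
Proof.
move=> x0 y0 z0; rewrite !muleA -!EFinM; congr (_%:E * _).
by field; rewrite gt_eqF.
Qed.

(** When the integrand ignores one of its two points, the weight of that point
    integrates out, and the other weight contributes its bounded sum of
    translates. This is where the hypothesis on the translates enters. *)
Lemma energy_inner_le :
  energy w (fun k t v => g (node w k v)) <= (Aa * Mb)%:E * \int[mu]_u (g u)%:E.
Proof.
have I0 : 0 <= \int[mu]_u (g u)%:E.
  by apply: integral_ge0 => u _; rewrite lee_fin.
rewrite -w_cancel// /energy lee_wpmul2l ?lee_fin ?invr_ge0 ?(ltW w0)//.
have h0 k : 0 <= \int[mu]_v (b v * (g (node w k v))%:E).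
  exact: inner_ge0.
apply: (@le_trans _ _ (\esum_(k in [set: int])
    (Aa%:E * \int[mu]_v (b v * (g (node w k v))%:E)))).
  apply: le_esum => k _; rewrite ge0_integralZr// lee_wpmul2r//.
rewrite esumZl// lee_wpmul2l ?lee_fin//.
exact: b_node.
Qed.

Lemma energy_outer_le :
  energy w (fun k t v => g (node w k t)) <= (Ab * Ma)%:E * \int[mu]_u (g u)%:E.
Proof.
have I0 : 0 <= \int[mu]_u (g u)%:E.
  by apply: integral_ge0 => u _; rewrite lee_fin.
rewrite -w_cancel// /energy lee_wpmul2l ?lee_fin ?invr_ge0 ?(ltW w0)//.
have mga k : measurable_fun [set: T] (fun t => a t * (g (node w k t))%:E).
  apply: emeasurable_funM => //; apply/measurable_EFinP.
  exact: (measurableT_comp mg (mnode k w0)).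
have ga0 k t : 0 <= a t * (g (node w k t))%:E by rewrite mule_ge0// lee_fin.
apply: (@le_trans _ _ (\esum_(k in [set: int])
    (Ab%:E * \int[mu]_t (a t * (g (node w k t))%:E)))).
  apply: le_esum => k _; rewrite -ge0_integralZl_EFin//.
  apply: le_ge0_integral => t; first by rewrite mule_ge0// inner_ge0.
  rewrite ge0_integralZr ?lee_fin// muleA [leRHS]muleCA muleA lee_wpmul2r ?lee_fin//.
  by rewrite lee_wpmul2l.
rewrite esumZl//; last by move=> k; exact: integral_ge0.
rewrite lee_wpmul2l ?lee_fin//.
exact: a_node.
Qed.
End bounds.
End energy.

(** * Oscillation, and functions whose oscillation vanishes *)
Lemma powR_normD_le {R : realType} (p x y : R) : 0 <= p ->
  `|x + y| `^ p <= 2 `^ p * (`|x| `^ p + `|y| `^ p).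
Proof.
move=> p0; wlog xy : x y / `|x| <= `|y| => [hw|].
  have [xy|/ltW yx] := leP `|x| `|y|; first exact: hw.
  by rewrite addrC [in leRHS]addrC; exact: hw.
apply: (@le_trans _ _ ((2 * `|y|) `^ p)).
  apply: ge0_ler_powR; rewrite ?nnegrE ?mulr_ge0//.
  by rewrite (le_trans (ler_normD _ _))// mulr_natl mulr2n lerD2r.
by rewrite powRM// ler_wpM2l ?powR_ge0// lerDr powR_ge0.
Qed.

Section oscillation.
Context d (T : measurableType d) (R : realType).
Variable mu : {sigma_finite_measure set T -> \bar R}.
Variable node : R -> int -> T -> T.
Hypothesis mnode : forall w k, 0 < w -> measurable_fun [set: T] (node w k).
Variables (p : R) (a b : T -> \bar R) (Aa Ab Ma Mb : R).
Hypothesis p1 : 1 <= p.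
Hypotheses (ma : measurable_fun [set: T] a) (a0 : forall x, (0 <= a x)%E).
Hypotheses (mb : measurable_fun [set: T] b) (b0 : forall x, (0 <= b x)%E).
Hypotheses (Ma0 : 0 <= Ma) (Mb0 : 0 <= Mb).
Hypotheses (intA : (\int[mu]_x a x <= Aa%:E)%E) (intB : (\int[mu]_x b x <= Ab%:E)%E).
Hypothesis a_node : forall w (g : T -> R), 0 < w ->
  measurable_fun [set: T] g -> (forall x, 0 <= g x) ->
  (\esum_(k in [set: int]) \int[mu]_v (a v * (g (node w k v))%:E) <=
  (w * Ma)%:E * \int[mu]_u (g u)%:E)%E.
Hypothesis b_node : forall w (g : T -> R), 0 < w ->
  measurable_fun [set: T] g -> (forall x, 0 <= g x) ->
  (\esum_(k in [set: int]) \int[mu]_v (b v * (g (node w k v))%:E) <=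
  (w * Mb)%:E * \int[mu]_u (g u)%:E)%E.

(** The variables [t] and [v] carry the weights [a] and [b]; for the sampling
    operator these are [|phi|] and [|psi|]. *)
Definition incr (f : T -> R) (w : R) (k : int) (t v : T) : R :=
  `|f (node w k v) - f (node w k t)| `^ p.

Definition osc (f : T -> R) (w : R) : \bar R := energy mu a b w (incr f w).

Let p0 : 0 <= p. Proof. exact: le_trans p1. Qed.

Lemma incr_ge0 f w k t v : 0 <= incr f w k t v.
Proof. exact: powR_ge0. Qed.

Lemma measurable_powR_norm d' (X : measurableType d') (h : X -> R) :
  measurable_fun [set: X] h -> measurable_fun [set: X] (fun x => `|h x| `^ p).
Proof.
move=> mh; apply: (measurableT_comp (measurable_powR p)).
exact: measurableT_comp.
Qed.

Lemma measurable_incr f w : 0 < w -> measurable_fun [set: T] f ->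
  jointly_measurable (incr f w).
Proof.
move=> w0 mf k; apply: measurable_powR_norm.
have mn := measurableT_comp mf (mnode k w0).
apply: measurable_funB.
- exact: (measurableT_comp mn measurable_snd).
- exact: (measurableT_comp mn measurable_fst).
Qed.

Lemma oscD (f g : T -> R) w : 0 < w -> measurable_fun [set: T] f -> measurable_fun [set: T] g ->
  (osc (f \+ g)%R w <= (2 `^ p)%:E * (osc f w + osc g w))%E.
Proof.
move=> w0 mf mg; have [mF mG] := (measurable_incr w0 mf, measurable_incr w0 mg).
have FG0 k t v : 0 <= incr f w k t v + incr g w k t v.
  by rewrite addr_ge0 ?incr_ge0.
have mFG : jointly_measurable (fun k t v => incr f w k t v + incr g w k t v).
  by move=> k; apply: measurable_funD; [exact: mF|exact: mG].
have <- := energyD mu ma a0 mb b0 w0 mF mG (incr_ge0 f w) (incr_ge0 g w).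
have <- := energyZ mu ma a0 mb b0 w0 (powR_ge0 2 p) mFG FG0.
apply: le_energy => // k t v; rewrite incr_ge0 /incr /=.
by rewrite opprD addrACA powR_normD_le.
Qed.

Lemma oscZ (f : T -> R) w c : 0 < w -> measurable_fun [set: T] f ->
  osc (fun x => c * f x)%R w = ((`|c| `^ p)%:E * osc f w)%E.
Proof.
move=> w0 mf.
have <- := energyZ mu ma a0 mb b0 w0 (powR_ge0 `|c| p)
  (measurable_incr w0 mf) (incr_ge0 f w).
congr (energy _ _ _ _ _).
apply/funext => k; apply/funext => t; apply/funext => v.
by rewrite /incr -mulrBr normrM powRM.
Qed.

(** Boundedness on L^p, uniformly in the dilation parameter: split the
    increment into its two values and integrate each of them separately. *)
Lemma osc_le (g : T -> R) w : 0 < w -> measurable_fun [set: T] g ->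
  (osc g w <= (2 `^ p * (Aa * Mb + Ab * Ma))%:E * \int[mu]_u (`|g u| `^ p)%:E)%E.
Proof.
move=> w0 mg; pose G u := `|g u| `^ p.
have mG : measurable_fun [set: T] G by exact: measurable_powR_norm.
have G0 u : 0 <= G u by exact: powR_ge0.
have m1 : jointly_measurable (fun k t v => G (node w k v)).
  move=> k; have mGk := measurableT_comp mG (mnode k w0).
  exact: (measurableT_comp mGk measurable_snd).
have m2 : jointly_measurable (fun k t v => G (node w k t)).
  move=> k; have mGk := measurableT_comp mG (mnode k w0).
  exact: (measurableT_comp mGk measurable_fst).
have Aa0 : 0 <= Aa by rewrite -lee_fin (le_trans _ intA)// integral_ge0.
have Ab0 : 0 <= Ab by rewrite -lee_fin (le_trans _ intB)// integral_ge0.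
apply: (@le_trans _ _ (energy mu a b w
    (fun k t v => 2 `^ p * (G (node w k v) + G (node w k t))))%R).
  apply: le_energy => // k t v; rewrite incr_ge0 /incr /=.
  by apply: (le_trans (powR_normD_le _ _ p0)); rewrite normrN.
have m12 : jointly_measurable (fun k t v => G (node w k v) + G (node w k t)).
  by move=> k; apply: measurable_funD; [exact: m1|exact: m2].
have g12 (k : int) (t v : T) : 0 <= G (node w k v) + G (node w k t).
  by rewrite addr_ge0.
have -> := energyZ mu ma a0 mb b0 w0 (powR_ge0 2 p) m12 g12.
rewrite EFinM -muleA; apply: lee_wpmul2l; first by rewrite lee_fin powR_ge0.
have -> := energyD mu ma a0 mb b0 w0 m1 m2 (fun _ _ _ => G0 _) (fun _ _ _ => G0 _).
rewrite EFinD ge0_muleDl ?lee_fin ?mulr_ge0//.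
apply: leeD.
  exact: (energy_inner_le ma a0 b0 w0 Mb0 intA (fun h => @b_node w h w0) mG G0).
exact: (energy_outer_le mnode ma a0 mb b0 w0 Ma0 intB
  (fun h => @a_node w h w0) mG G0).
Qed.

Definition vanishing (f : T -> R) :=
  forall e, 0 < e -> \forall w \near +oo%R, (osc f w <= e%:E)%E.

Lemma vanishing_dominated (f g h : T -> R) (c : R) : 0 < c ->
  (forall w, 0 < w -> (osc h w <= c%:E * (osc f w + osc g w))%E) ->
  vanishing f -> vanishing g -> vanishing h.
Proof.
move=> c0 hfg vf vg e e0; pose delta := e / (2 * c).
have delta0 : 0 < delta by rewrite divr_gt0// mulr_gt0.
have vfd := vf _ delta0; have vgd := vg _ delta0.
apply: filterS3 (nbhs_pinfty_gt (num_real 0)) vfd vgd => w w0 fw gw.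
have := hfg w w0; move=> /le_trans; apply.
apply: (@le_trans _ _ (c%:E * (delta%:E + delta%:E))%E).
  rewrite lee_wpmul2l ?lee_fin ?(ltW c0)//.
  exact: (leeD fw gw).
rewrite -EFinD -EFinM lee_fin /delta le_eqVlt; apply/orP; left; apply/eqP.
by field; rewrite gt_eqF.
Qed.

Lemma vanishingD (f g : T -> R) : measurable_fun [set: T] f ->
  measurable_fun [set: T] g ->
  vanishing f -> vanishing g -> vanishing (f \+ g)%R.
Proof.
move=> mf mg; apply: (vanishing_dominated (powR_gt0 p (ltr0n _ 2))) => w w0.
exact: oscD.
Qed.

(** Made for unions of sets: the increments of the indicator of a union are
    dominated by those of the two indicators without any extra factor. *)
Lemma vanishing_incr_le (f g h : T -> R) : measurable_fun [set: T] f ->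
  measurable_fun [set: T] g ->
  (forall w k t v, incr h w k t v <= incr f w k t v + incr g w k t v) ->
  vanishing f -> vanishing g -> vanishing h.
Proof.
move=> mf mg hfg; apply: (vanishing_dominated ltr01) => w w0; rewrite mul1e.
have := energyD mu ma a0 mb b0 w0 (measurable_incr w0 mf) (measurable_incr w0 mg)
  (incr_ge0 f w) (incr_ge0 g w).
rewrite /osc => <-; apply: le_energy => // k t v.
by rewrite incr_ge0 hfg.
Qed.

Lemma vanishingZ (f : T -> R) c : measurable_fun [set: T] f ->
  vanishing f -> vanishing (fun x => c * f x).
Proof.
move=> mf vf e e0; pose delta := e / (`|c| `^ p + 1).
have p20 : 0 < `|c| `^ p + 1 by rewrite ltr_wpDl ?powR_ge0.
have delta0 : 0 < delta by rewrite divr_gt0.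
have vfd := vf _ delta0.
apply: filterS2 (nbhs_pinfty_gt (num_real 0)) vfd => w w0 fw.
rewrite oscZ//; apply: (@le_trans _ _ ((`|c| `^ p)%:E * delta%:E)%E).
  by rewrite lee_wpmul2l ?lee_fin ?powR_ge0.
rewrite -EFinM lee_fin /delta mulrA ler_pdivrMr// mulrC ler_pM2l// lerDl.
exact: ler01.
Qed.

(** The uniform bound [osc_le] makes the class closed in L^p: the oscillation
    of [f] is at most that of a good approximation [g], plus that of [f - g],
    which is small for every [w] simultaneously. *)
Lemma vanishing_closed (f : T -> R) : measurable_fun [set: T] f ->
  (forall e, 0 < e -> exists g : T -> R, [/\ measurable_fun [set: T] g, vanishing g &
     (\int[mu]_u (`|f u - g u| `^ p)%:E <= e%:E)%E]) ->
  vanishing f.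
Proof.
move=> mf H e e0; pose C := 2 `^ p * (Aa * Mb + Ab * Ma) + 1.
have Aa0 : 0 <= Aa by rewrite -lee_fin (le_trans _ intA)// integral_ge0.
have Ab0 : 0 <= Ab by rewrite -lee_fin (le_trans _ intB)// integral_ge0.
have C0 : 0 < C by rewrite ltr_wpDl// mulr_ge0 ?powR_ge0// addr_ge0// mulr_ge0.
have p20 : 0 < 2 `^ p :> R by rewrite powR_gt0.
pose delta := e / (2 * 2 `^ p).
have delta0 : 0 < delta by rewrite divr_gt0// mulr_gt0.
have dC0 : 0 < delta / C by rewrite divr_gt0.
have [g [mg vg fg]] := H _ dC0.
have vgd := vg _ delta0.
apply: filterS2 (nbhs_pinfty_gt (num_real 0)) vgd => w w0 gw.
have -> : f = ((f \- g) \+ g)%R by apply/funext => x /=; rewrite subrK.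
have mfg : measurable_fun [set: T] (f \- g)%R by exact: measurable_funB.
have := oscD w0 mfg mg; move=> /le_trans; apply.
apply: (@le_trans _ _ ((2 `^ p)%:E * (delta%:E + delta%:E))%E).
  rewrite lee_wpmul2l ?lee_fin ?(ltW p20)//.
  apply: leeD; last exact: gw.
  have := osc_le w0 mfg; move=> /le_trans; apply.
  apply: (@le_trans _ _ (C%:E * (delta / C)%:E)%E); last first.
    by rewrite -EFinM lee_fin mulrC divfK// gt_eqF.
  apply: lee_pmul => //.
  - by rewrite lee_fin mulr_ge0 ?powR_ge0// addr_ge0// mulr_ge0.
  - by apply: integral_ge0 => u _; rewrite lee_fin powR_ge0.
  - by rewrite lee_fin lerDl.
rewrite -EFinD -EFinM lee_fin /delta le_eqVlt; apply/orP; left; apply/eqP.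
by field; rewrite gt_eqF.
Qed.
End oscillation.

(** * Induction over L^p functions *)

(** Continuity of the power at 0, in the form needed for dominated
    convergence: below 1, a power with exponent at least 1 only decreases. *)
Lemma powR_norm_cvg0 {R : realType} (p : R) (u : nat -> R) : 1 <= p ->
  u @ \oo --> 0 -> `|u n| `^ p @[n --> \oo] --> 0.
Proof.
move=> p1 u0; have nu0 : `|u n| @[n --> \oo] --> 0.
  by rewrite -[X in _ --> X](@normr0 _ R); exact: cvg_norm.
apply: (@squeeze_cvgr _ _ _ _ (cst 0) (fun n => `|u n|)) => //; last exact: cvg_cst.
have : \forall n \near \oo, `|u n| <= 1.
  have /cvgr0Pnorm_le := u0; apply; exact: ltr01.
apply: filterS => n un1; rewrite powR_ge0/=.
have [->|un0] := eqVneq `|u n| 0.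
  by rewrite powR0// gt_eqF// (lt_le_trans ltr01).
by apply: ge1r_powR => //; rewrite un1 andbT lt0r un0 normr_ge0.
Qed.

(** To prove a property of all L^p functions it suffices that it hold for the
    indicators of sets of finite measure and survive sums, multiples and L^p
    limits: pass from indicators to simple functions, then to nonnegative
    functions by the increasing approximation and dominated convergence, then
    to differences. *)
Section Lp_induction.
Context d (T : measurableType d) (R : realType).
Variable mu : {measure set T -> \bar R}.
Variable p : R.
Hypothesis p1 : 1 <= p.
Variable P : (T -> R) -> Prop.
Hypothesis P_indic : forall A, measurable A -> (mu A < +oo)%E -> P \1_A.
Hypothesis PD : forall f g : T -> R, measurable_fun [set: T] f ->
  measurable_fun [set: T] g -> P f -> P g -> P (f \+ g).
Hypothesis PZ : forall (f : T -> R) c, measurable_fun [set: T] f ->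
  P f -> P (fun x => c * f x).
Hypothesis Pclosed : forall f : T -> R, measurable_fun [set: T] f ->
  (forall e, 0 < e -> exists g : T -> R, [/\ measurable_fun [set: T] g, P g &
     (\int[mu]_u (`|f u - g u| `^ p)%:E <= e%:E)%E]) -> P f.

Let P0 : P (cst 0).
Proof.
have -> : cst 0 = \1_set0 :> (T -> R) by rewrite indic0.
by apply: P_indic => //; rewrite measure0.
Qed.

Import HBNNSimple.

Lemma Lp_induction_nnsfun (g : {nnsfun T >-> R}) :
  (\int[mu]_u (`|g u| `^ p)%:E < +oo)%E -> P g.
Proof.
move=> goo.
have p0 : 0 < p by exact: lt_le_trans p1.
have mg r : measurable (g @^-1` [set r]) by exact: measurable_funPTI.
pose F s x := \sum_(r <- s) (r * \1_(g @^-1` [set r]) x).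
have mterm r : measurable_fun [set: T] (fun x => r * \1_(g @^-1` [set r]) x).
  by apply: measurable_funM => //; exact: measurable_indic.
have mF s : measurable_fun [set: T] (F s).
  by apply: measurable_sum => r; exact: mterm.
have PF s : P (F s).
  elim: s => [|r s IH].
    by rewrite (_ : F [::] = cst 0)//; apply/funext => x; rewrite /F big_nil.
  rewrite (_ : F (r :: s) = (fun x => r * \1_(g @^-1` [set r]) x) \+ F s); last first.
    by apply/funext => x; rewrite /F big_cons.
  apply: PD => //.
  (* the level set of the value 0 may have infinite measure *)
  have [->|r0] := eqVneq r 0.
    rewrite (_ : (fun _ => _) = cst 0)//.
    by apply/funext => x; rewrite mul0r.
  apply: PZ; first exact: measurable_indic.
  apply: P_indic => //.
  (* a nonzero level set has finite measure by Markov's inequality *)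
  have rp : 0 < `|r| `^ p by rewrite powR_gt0// normr_gt0.
  have : ((`|r| `^ p)%:E * mu (g @^-1` [set r]) < +oo)%E.
    rewrite -(setIT (g @^-1` _)) -integral_indic// -ge0_integralZl_EFin//; last first.
      by apply/measurable_EFinP; exact: measurable_indic.
    apply: le_lt_trans goo; apply: le_ge0_integral => x.
      by rewrite mule_ge0// lee_fin ?powR_ge0.
    rewrite indicE; have [|_] := boolP (x \in _); last first.
      by rewrite mule0 lee_fin powR_ge0.
    by rewrite inE/= => ->; rewrite mule1.
  by rewrite !ltey; apply: contra_neq => ->; rewrite gt0_muley ?lte_fin.
rewrite (_ : (g : T -> R) = F (finmap.enum_fset (fset_set (range g))))//.
by apply/funext => x; rewrite fimfunE fsbig_finite.
Qed.

Lemma Lp_induction_nonneg (f : T -> R) : measurable_fun [set: T] f ->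
  (forall x, 0 <= f x) -> (\int[mu]_u (`|f u| `^ p)%:E < +oo)%E -> P f.
Proof.
move=> mf f0 foo; have p0 : 0 <= p by exact: le_trans p1.
have mEf : measurable_fun [set: T] (EFin \o f) by exact/measurable_EFinP.
pose g := nnsfun_approx measurableT mEf.
have gf x : g n x @[n --> \oo] --> f x.
  have := @cvg_nnsfun_approx _ _ _ _ measurableT _ mEf (fun x _ => f0 x) x Logic.I.
  by move/fine_cvg.
have gle n x : g n x <= f x.
  rewrite -(cvg_lim (@Rhausdorff R) (gf x)).
  apply: nondecreasing_cvgn_le; last by apply/cvg_ex; exists (f x).
  by move=> i j ij; exact/lefP/nd_nnsfun_approx.
have g0 n x : 0 <= g n x by exact: fun_ge0.
have mabs (h : T -> R) : measurable_fun [set: T] h ->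
    measurable_fun [set: T] (fun x => (`|h x| `^ p)%:E).
  by move=> mh; apply/measurable_EFinP; exact: measurable_powR_norm.
have cvg0 : (\int[mu]_x (`|f x - g n x| `^ p)%:E @[n --> \oo] --> 0)%E.
  rewrite -[X in _ --> X](integral0 mu [set: T]).
  apply: (@dominated_cvg _ _ _ mu [set: T] measurableT
    (fun n x => (`|f x - g n x| `^ p)%:E) (cst 0%E) (fun x => (`|f x| `^ p)%:E)).
  - by move=> n; apply: mabs; exact: measurable_funB.
  - move=> x _; apply: cvg_EFin; first by apply: nearW.
    apply: powR_norm_cvg0 => //.
    rewrite -(subrr (f x)); apply: cvgB => //; exact: cvg_cst.
  - by [].
  - apply/integrableP; split; first exact: mabs.
    by under eq_integral do rewrite gee0_abs ?lee_fin ?powR_ge0//.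
  - move=> n x _; rewrite gee0_abs ?lee_fin ?powR_ge0//.
    apply: ge0_ler_powR => //; rewrite ?nnegrE//.
    by rewrite !ger0_norm ?subr_ge0// gerBl.
apply: Pclosed => // e e0.
have /fine_cvgP [] := cvg0 => fin0 /cvgr0Pnorm_le /(_ _ e0) le0.
have [n [fin_n le_n]] : exists n, (\int[mu]_x (`|f x - g n x| `^ p)%:E)%E \is a fin_num
   /\ `|fine (\int[mu]_x (`|f x - g n x| `^ p)%:E)%E| <= e.
  by near \oo => n; exists n; split; near: n.
have poo : (\int[mu]_x (`|g n x| `^ p)%:E < +oo)%E.
  apply: le_lt_trans foo; apply: le_ge0_integral => x; rewrite lee_fin ?powR_ge0//.
  by apply: ge0_ler_powR => //; rewrite ?nnegrE// !ger0_norm.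
exists (g n); split => //; first exact: Lp_induction_nnsfun.
by rewrite -(fineK fin_n) lee_fin (le_trans (ler_norm _)).
Unshelve. all: by end_near. Qed.

Lemma Lp_induction (f : T -> R) : measurable_fun [set: T] f ->
  (\int[mu]_u (`|f u| `^ p)%:E < +oo)%E -> P f.
Proof.
move=> mf foo; have p0 : 0 <= p by exact: le_trans p1.
have le_f (h : T -> R) : (forall x, `|h x| <= `|f x|) ->
    (\int[mu]_u (`|h u| `^ p)%:E < +oo)%E.
  move=> hf; apply: le_lt_trans foo; apply: le_ge0_integral => x.
    by rewrite lee_fin powR_ge0.
  by rewrite lee_fin; apply: ge0_ler_powR => //; rewrite ?nnegrE.
rewrite (_ : f = (f^\+ \+ (fun x => -1 * f^\- x))%R); last first.
  by rewrite -[LHS](funrposBneg f); apply/funext => x /=; rewrite mulN1r.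
apply: PD.
- exact: measurable_funrpos.
- by apply: measurable_funM => //; exact: measurable_funrneg.
- apply: (Lp_induction_nonneg (measurable_funrpos mf) (funrpos_ge0 f)).
  apply: le_f => x; rewrite ger0_norm ?funrpos_ge0// /funrpos.
  by rewrite ge_max normr_ge0 ler_norm.
- apply: PZ; first exact: measurable_funrneg.
  apply: (Lp_induction_nonneg (measurable_funrneg mf) (funrneg_ge0 f)).
  apply: le_f => x; rewrite ger0_norm ?funrneg_ge0// /funrneg.
  by rewrite ge_max normr_ge0 -normrN ler_norm.
Qed.
End Lp_induction.

(** * A criterion for vanishing oscillation *)
Section energy_sum.
Local Open Scope ereal_scope.
Context d (T : measurableType d) (R : realType).
Variable mu : {sigma_finite_measure set T -> \bar R}.
Variables (a b : T -> R) (w : R).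
Hypotheses (ma : measurable_fun [set: T] a) (a0 : forall x, (0 <= a x)%R).
Hypotheses (mb : measurable_fun [set: T] b) (b0 : forall x, (0 <= b x)%R).
Hypothesis w0 : (0 < w)%R.

Let ea0 x : 0 <= (a x)%:E. Proof. by rewrite lee_fin. Qed.
Let eb0 x : 0 <= (b x)%:E. Proof. by rewrite lee_fin. Qed.
Let mea : measurable_fun [set: T] (EFin \o a). Proof. exact/measurable_EFinP. Qed.
Let meb : measurable_fun [set: T] (EFin \o b). Proof. exact/measurable_EFinP. Qed.

(** Exchanging the sum with both integrals leaves, for fixed [t] and [v], the
    sum over [k] of the increments: this is the quantity that can be counted. *)
Lemma energy_le_sum (H : int -> T -> T -> R) (E : T -> T -> R) :
  jointly_measurable H -> (forall k t v, 0 <= H k t v)%R ->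
  (forall t v, \esum_(k in [set: int]) (H k t v)%:E <= (w * E t v)%:E) ->
  energy mu (EFin \o a) (EFin \o b) w H <=
  \int[mu]_t ((a t)%:E * \int[mu]_v ((b v)%:E * (E t v)%:E)).
Proof.
move=> mH H0 HE; rewrite /energy /=.
have wi0 : (0 <= w^-1)%R by rewrite invr_ge0 ltW.
have bH0 k t v : 0 <= (b v)%:E * (H k t v)%:E by rewrite mule_ge0 ?lee_fin.
have mbH k t := measurable_weighted_section meb k t mH.
have I0 k t : 0 <= \int[mu]_v ((b v)%:E * (H k t v)%:E) by exact: integral_ge0.
have mI k := @measurable_inner _ _ _ mu _ meb eb0 H k mH (H0 k).
have aI0 k t : 0 <= (a t)%:E * \int[mu]_v ((b v)%:E * (H k t v)%:E).
  by rewrite mule_ge0.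
have maI k : measurable_fun [set: T]
    (fun t => (a t)%:E * \int[mu]_v ((b v)%:E * (H k t v)%:E)).
  by apply: emeasurable_funM => //; exact: mI.
rewrite -ge0_integral_esum_int//.
rewrite -ge0_integralZl_EFin//; last 2 first.
- by move=> t _; apply: esum_ge0.
- exact: measurable_esum_int.
apply: le_ge0_integral => t.
  by rewrite mule_ge0 ?lee_fin// esum_ge0.
rewrite esumZl// muleCA; apply: lee_wpmul2l => //.
rewrite -ge0_integral_esum_int// -ge0_integralZl_EFin//; last 2 first.
- by move=> v _; apply: esum_ge0.
- exact: measurable_esum_int.
apply: le_ge0_integral => v.
  by rewrite mule_ge0 ?lee_fin// esum_ge0.
rewrite esumZl//; last by move=> k; rewrite lee_fin.
rewrite muleCA; apply: lee_wpmul2l => //.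
rewrite muleC lee_pdivrMr//.
by rewrite (le_trans (HE t v))// EFinM muleC.
Qed.

Lemma weighted_separable_le (Aa Ab Ha Hb e : R) (h : T -> R) :
  (0 <= e)%R -> measurable_fun [set: T] h -> (forall x, 0 <= h x)%R ->
  (0 <= Ab)%R -> (0 <= Hb)%R ->
  \int[mu]_x (a x)%:E <= Aa%:E -> \int[mu]_x (b x)%:E <= Ab%:E ->
  \int[mu]_x (a x * h x)%:E <= Ha%:E -> \int[mu]_x (b x * h x)%:E <= Hb%:E ->
  \int[mu]_t ((a t)%:E * \int[mu]_v ((b v)%:E * (e + h t + h v)%:E)) <=
  (e * Aa * Ab + Ha * Ab + Aa * Hb)%:E.
Proof.
move=> e0 mh h0 Ab0 Hb0 iA iB iHa iHb.
have inner t : \int[mu]_v ((b v)%:E * (e + h t + h v)%:E) <=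
    ((e + h t) * Ab + Hb)%:E.
  have eh0 : (0 <= e + h t)%R by rewrite addr_ge0.
  rewrite [X in (X <= _)%E](_ : _ =
      \int[mu]_v ((e + h t)%:E * (b v)%:E + (b v * h v)%:E)); last first.
    by apply: eq_integral => v _; rewrite -!EFinM -EFinD; congr (_%:E); ring.
  rewrite ge0_integralD//; last 4 first.
  - by move=> v _; rewrite -EFinM lee_fin mulr_ge0.
  - by apply: emeasurable_funM => //; exact: measurable_cst.
  - by move=> v _; rewrite lee_fin mulr_ge0.
  - by apply/measurable_EFinP; exact: measurable_funM.
  rewrite ge0_integralZl_EFin// [leRHS]EFinD [in leRHS]EFinM.
  by apply: leeD => //; apply: lee_wpmul2l; rewrite ?lee_fin.
apply: (@le_trans _ _ (\int[mu]_t
    ((e * Ab + Hb)%:E * (a t)%:E + Ab%:E * (a t * h t)%:E))).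
  apply: le_ge0_integral => t.
    rewrite mule_ge0//; apply: integral_ge0 => v _.
    by rewrite -EFinM lee_fin mulr_ge0// !addr_ge0.
  apply: (le_trans (lee_wpmul2l _ (inner t))) => //.
  rewrite -!EFinM -EFinD lee_fin.
  by rewrite le_eqVlt; apply/orP; left; apply/eqP; ring.
have mah : measurable_fun [set: T] (fun t => (a t * h t)%:E).
  by apply/measurable_EFinP; exact: measurable_funM.
have ah0 t : 0 <= (a t * h t)%:E by rewrite lee_fin mulr_ge0.
have eAH : (0 <= e * Ab + Hb)%R by rewrite addr_ge0// mulr_ge0.
rewrite ge0_integralD//; last 4 first.
- by move=> v _; rewrite mule_ge0// lee_fin.
- by apply: emeasurable_funM => //; exact: measurable_cst.
- by move=> v _; rewrite mule_ge0// lee_fin.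
- by apply: emeasurable_funM => //; exact: measurable_cst.
rewrite !ge0_integralZl_EFin//.
apply: (@le_trans _ _ ((e * Ab + Hb)%:E * Aa%:E + Ab%:E * Ha%:E)).
  by apply: leeD; apply: lee_wpmul2l; rewrite ?lee_fin.
rewrite -!EFinM -EFinD lee_fin.
by rewrite le_eqVlt; apply/orP; left; apply/eqP; ring.
Qed.
End energy_sum.

Section tails.
Context d (T : measurableType d) (R : realType).
Variable mu : {measure set T -> \bar R}.

(** The indicators of [F n] tend to 0 pointwise, so this is dominated
    convergence. On the line, [F n] is the complement of [[-n, n]]. *)
Lemma tail_integral_le (F : (set T)^nat) (a : T -> R) (C e : R) :
  (forall n, measurable (F n)) -> (forall x, \forall n \near \oo, ~ F n x) ->
  measurable_fun [set: T] a ->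
  (forall x, 0 <= a x) -> (\int[mu]_x (a x)%:E < +oo)%E -> 0 <= C -> 0 < e ->
  \forall n \near \oo, (\int[mu]_x (a x * (C * \1_(F n) x))%:E <= e%:E)%E.
Proof.
move=> mF Foo ma a0 aoo C0 e0.
have mterm N : measurable_fun [set: T] (fun x => (a x * (C * \1_(F N) x))%:E).
  apply/measurable_EFinP; apply: measurable_funM => //.
  apply: measurable_funM => //; apply: measurable_indic.
have cvg0 : (\int[mu]_x (a x * (C * \1_(F n) x))%:E @[n --> \oo] --> 0)%E.
  rewrite -[X in _ --> X](integral0 mu [set: T]).
  apply: (@dominated_cvg _ _ _ mu [set: T] measurableT
    (fun n x => (a x * (C * \1_(F n) x))%:E) (cst 0%E) (fun x => (C * a x)%:E)).
  - exact: mterm.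
  - move=> x _; apply: cvg_near_cst.
    near=> n; rewrite indicE memNset ?mulr0//.
    by near: n; exact: Foo.
  - by [].
  - apply/integrableP; split; first by apply/measurable_EFinP; exact: measurable_funM.
    under eq_integral do rewrite gee0_abs ?lee_fin ?mulr_ge0// EFinM.
    rewrite ge0_integralZl_EFin//; last 2 first.
    - by move=> x _; rewrite lee_fin.
    - exact/measurable_EFinP.
    by rewrite lte_mul_pinfty ?lee_fin.
  - move=> n x _; have i0 : (0 : R) <= \1_(F n) x by rewrite indicE ler0n.
    have i1 : \1_(F n) x <= (1 : R) by rewrite indicE lern1 leq_b1.
    rewrite gee0_abs ?lee_fin ?mulr_ge0//.
    by rewrite mulrA (mulrC (a x)) ler_piMr ?mulr_ge0.
have /fine_cvgP [] := cvg0 => fin0 /cvgr0Pnorm_le /(_ _ e0) le0.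
near=> n.
have fin_n : (\int[mu]_x (a x * (C * \1_(F n) x))%:E)%E \is a fin_num by near: n.
rewrite -(fineK fin_n) lee_fin (le_trans (ler_norm _))//; by near: n.
Unshelve. all: by end_near. Qed.
End tails.

(** Where both variables stay out of [F n], the sum of the increments is
    bounded independently of [w], hence is killed by the factor [1 / w] of the
    energy. Elsewhere it is of order [w], but there one of the two weights has
    a small integral. *)
Section vanishing_count.
Context d (T : measurableType d) (R : realType).
Variable mu : {sigma_finite_measure set T -> \bar R}.
Variable node : R -> int -> T -> T.
Hypothesis mnode : forall w k, 0 < w -> measurable_fun [set: T] (node w k).
Variables (p : R) (a b : T -> R) (Aa Ab : R).
Hypotheses (ma : measurable_fun [set: T] a) (a0 : forall x, 0 <= a x).
Hypotheses (mb : measurable_fun [set: T] b) (b0 : forall x, 0 <= b x).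
Hypothesis intA : (\int[mu]_x (a x)%:E <= Aa%:E)%E.
Hypothesis intB : (\int[mu]_x (b x)%:E <= Ab%:E)%E.
Variable F : (set T)^nat.
Hypotheses (mF : forall n, measurable (F n))
  (Foo : forall x, \forall n \near \oo, ~ F n x).

Lemma vanishing_count (f : T -> R) (C : R) (B : nat -> R) :
  measurable_fun [set: T] f -> 0 <= C -> (forall n, 0 <= B n) ->
  (forall w t v, 1 <= w ->
    (\esum_(k in [set: int]) (incr node p f w k t v)%:E <= (w * C)%:E)%E) ->
  (forall n w t v, 0 < w -> ~ F n t -> ~ F n v ->
    (\esum_(k in [set: int]) (incr node p f w k t v)%:E <= (B n)%:E)%E) ->
  vanishing mu node p (EFin \o a) (EFin \o b) f.
Proof.
move=> mf C0 B0 HC HB e e0.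
have Aa0 : 0 <= Aa by rewrite -lee_fin (le_trans _ intA)// integral_ge0// => x _; rewrite lee_fin.
have Ab0 : 0 <= Ab by rewrite -lee_fin (le_trans _ intB)// integral_ge0// => x _; rewrite lee_fin.
pose s := e / (2 * (Aa + Ab + 1)).
have AAb : 0 < Aa + Ab + 1 by rewrite ltr_wpDl// addr_ge0.
have s0 : 0 < s by rewrite divr_gt0// mulr_gt0.
have aoo : (\int[mu]_x (a x)%:E < +oo)%E by rewrite (le_lt_trans intA)// ltry.
have boo : (\int[mu]_x (b x)%:E < +oo)%E by rewrite (le_lt_trans intB)// ltry.
have [N [tailA tailB]] : exists N,
    (\int[mu]_x (a x * (C * \1_(F N) x))%:E <= s%:E)%E /\
    (\int[mu]_x (b x * (C * \1_(F N) x))%:E <= s%:E)%E.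
  have [N _ HN] := filterI (tail_integral_le mF Foo ma a0 aoo C0 s0)
    (tail_integral_le mF Foo mb b0 boo C0 s0).
  by exists N; exact: (HN N (leqnn N)).
pose W := 2 * (B N * Aa * Ab) / e.
apply: filterS2 (nbhs_pinfty_ge (num_real 1)) (nbhs_pinfty_ge (num_real W)) => w w1 wW.
have w0 : 0 < w by exact: lt_le_trans w1.
pose h x := C * \1_(F N) x.
have mh : measurable_fun [set: T] h.
  by apply: measurable_funM => //; exact: measurable_indic.
have h0 x : 0 <= h x by rewrite mulr_ge0// indicE ler0n.
have mH := measurable_incr mnode p w0 mf.
have H0 k t v := incr_ge0 node p f w k t v.
have HE t v : (\esum_(k in [set: int]) (incr node p f w k t v)%:E <=
    (w * (B N / w + h t + h v))%:E)%E.
  have wB : w * (B N / w) = B N by rewrite mulrC divfK// gt_eqF.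
  (* one far variable is enough to produce the constant [C] *)
  have farC (x y : R) : 0 <= x -> C <= y -> (w * C) <= w * (B N / w + x + y).
    move=> x0 Cy; rewrite ler_pM2l//.
    by rewrite (le_trans Cy)// lerDr addr_ge0// divr_ge0// ltW.
  have [tF|tF] := pselect (F N t).
    have ht : C <= h t by rewrite /h indicE mem_set// mulr1.
    by rewrite (le_trans (HC _ _ _ w1))// lee_fin addrAC farC.
  have [vF|vF] := pselect (F N v).
    have hv : C <= h v by rewrite /h indicE mem_set// mulr1.
    by rewrite (le_trans (HC _ _ _ w1))// lee_fin farC.
  rewrite (le_trans (HB N _ _ _ w0 tF vF))// lee_fin -{1}wB ler_pM2l//.
  by rewrite -addrA lerDl addr_ge0.
have := energy_le_sum mu ma a0 mb b0 w0 mH H0 HE.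
move=> /le_trans; apply.
have Bw0 : 0 <= B N / w by rewrite divr_ge0// ltW.
have := weighted_separable_le ma a0 mb b0 Bw0 mh h0 Ab0 (ltW s0) intA intB tailA tailB.
move=> /le_trans; apply; rewrite lee_fin.
have -> : B N / w * Aa * Ab + s * Ab + Aa * s = B N * Aa * Ab / w + s * (Aa + Ab).
  by field; rewrite gt_eqF.
have h1 : B N * Aa * Ab / w <= e / 2.
  move: wW; rewrite /W ler_pdivrMr// => wW; rewrite ler_pdivrMr//; lra.
have h2 : s * (Aa + Ab) <= e / 2.
  have : s * (2 * (Aa + Ab + 1)) = e by rewrite /s divfK// gt_eqF// mulr_gt0.
  lra.
by rewrite [leRHS]splitr; apply: lerD.
Qed.
End vanishing_count.

(** * From the oscillation to the norm of the error *)
Section power_inequalities.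
Context {R : realType}.
Implicit Types p s y C : R.

(** If [y > s] then [(y / s)^(p - 1) >= 1], so the second term alone is at
    least [y]. *)
Lemma le_add_powR p s y : 1 <= p -> 0 < s -> 0 <= y ->
  y <= s + s `^ (1 - p) * y `^ p.
Proof.
move=> p1 s0 y0; have [ys|sy] := leP y s.
  by rewrite (le_trans ys)// lerDl mulr_ge0 ?powR_ge0.
have yp : 0 < y by exact: lt_trans sy.
apply: (@le_trans _ _ (s `^ (1 - p) * y `^ p)); last by rewrite lerDr ltW.
have -> : y `^ p = y `^ (p - 1) * y.
  by rewrite mulrC mulr_powRB1// ?(lt_le_trans ltr01)// ltW.
rewrite mulrA ler_peMl ?(ltW yp)//.
have -> : 1 - p = - (p - 1) by ring.
rewrite powRN mulrC ler_pdivlMr ?powR_gt0// mul1r.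
by apply: ge0_ler_powR; rewrite ?nnegrE ?subr_ge0 ?(ltW s0) ?(ltW yp) ?(ltW sy).
Qed.

(** The hypothesis is what [le_add_powR] gives after averaging. Taking for [s]
    the value [y / (2 C)] makes the first term equal to [y / 2]; absorbing it
    in the left-hand side yields an inequality of Jensen type. *)
Lemma powR_le_of_le_add p C y (J : \bar R) : 1 <= p -> 0 < C -> 0 <= y ->
  (0 <= J)%E ->
  (forall s, 0 < s -> (y%:E <= (s * C)%:E + (s `^ (1 - p))%:E * J)%E) ->
  ((y `^ p)%:E <= ((2 * C) `^ (p - 1) * 2)%:E * J)%E.
Proof.
move=> p1 C0 y0 J0 H; have C20 : 0 < 2 * C by rewrite mulr_gt0.
have p0 : 0 < p by exact: lt_le_trans p1.
have [<-|yN0] := eqVneq 0 y.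
  by rewrite powR0 ?gt_eqF// mule_ge0// lee_fin mulr_ge0// powR_ge0.
have yp : 0 < y by rewrite lt_neqAle yN0.
have s0 : 0 < y / (2 * C) by rewrite divr_gt0.
have := H _ s0; move: J0; clear H; case: J => [J|_|//]; last first.
  move=> _; rewrite gt0_muley; first exact: leey.
  by rewrite lte_fin mulr_gt0 ?powR_gt0.
rewrite -!EFinM -EFinD !lee_fin => J0 Hy.
have hy : y / 2 <= (y / (2 * C)) `^ (1 - p) * J.
  have e1 : y / (2 * C) * C = y / 2 by field; rewrite gt_eqF.
  move: Hy; rewrite e1; lra.
have -> : y `^ p = y `^ (p - 1) * y.
  by rewrite mulrC mulr_powRB1// ltW.
have e2 : (y / (2 * C)) `^ (1 - p) * y `^ (p - 1) = (2 * C) `^ (p - 1).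
  have -> : 1 - p = - (p - 1) by ring.
  have E : y `^ (p - 1) = (y / (2 * C)) `^ (p - 1) * (2 * C) `^ (p - 1).
    by rewrite -powRM ?(ltW s0) ?(ltW C20)// divfK// gt_eqF.
  by rewrite powRN E mulKf// gt_eqF// powR_gt0.
have -> : y `^ (p - 1) * y = 2 * (y `^ (p - 1) * (y / 2)) by field.
rewrite -e2 [leRHS](_ : _ = 2 * (y `^ (p - 1) * ((y / (2 * C)) `^ (1 - p) * J))); last by ring.
by rewrite ler_pM2l// ler_wpM2l// powR_ge0.
Qed.
End power_inequalities.

(** The local averages of an L^p function are finite because
    [|f| <= 1 + |f|^p], which is the case [s = 1] of [le_add_powR]. *)
Section averages.
Context d (T : measurableType d) (R : realType).
Variable mu : {measure set T -> \bar R}.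
Implicit Types (f g : T -> R).

Lemma integral_norm_mul_le (p M : R) (f g : T -> R) : 1 <= p -> 0 <= M ->
  measurable_fun [set: T] f -> measurable_fun [set: T] g ->
  (forall x, `|g x| <= M) ->
  (\int[mu]_x (`|g x * f x|)%:E <=
   \int[mu]_x (`|g x|)%:E + M%:E * \int[mu]_x (`|f x| `^ p)%:E)%E.
Proof.
move=> p1 M0 mf mg gM.
have mng : measurable_fun [set: T] (fun x => (`|g x|)%:E).
  by apply/measurable_EFinP; exact: measurableT_comp.
have mfp : measurable_fun [set: T] (fun x => (`|f x| `^ p)%:E).
  by apply/measurable_EFinP; exact: measurable_powR_norm.
rewrite -ge0_integralZl_EFin//.
rewrite -ge0_integralD//; last 2 first.
- by move=> x _; rewrite -EFinM lee_fin mulr_ge0// powR_ge0.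
- by apply: emeasurable_funM => //; exact: measurable_cst.
apply: le_ge0_integral => x; first by rewrite lee_fin.
rewrite -EFinM -EFinD lee_fin normrM.
have := le_add_powR p1 ltr01 (normr_ge0 (f x)); rewrite powR1 mul1r => fx.
apply: (@le_trans _ _ (`|g x| * (1 + `|f x| `^ p))); first by rewrite ler_wpM2l.
by rewrite mulrDr mulr1 lerD2l ler_wpM2r// powR_ge0.
Qed.

(** A mean value minus a constant is the mean of the difference. *)
Lemma Rintegral_sub_scaled_le (w y : R) (f g : T -> R) : 0 <= w ->
  mu.-integrable [set: T] (EFin \o g) ->
  mu.-integrable [set: T] (fun x => (g x * f x)%:E) ->
  w * \int[mu]_x g x = 1 ->
  ((`|w * \int[mu]_x (g x * f x) - y|)%:E <=
   w%:E * \int[mu]_x (`|g x|%:E * (`|f x - y|)%:E))%E.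
Proof.
move=> w0 ig igf g1.
have igy : mu.-integrable [set: T] (EFin \o (fun x => y * g x)).
  exact: (integrableZl measurableT y ig).
have -> : w * \int[mu]_x (g x * f x) - y = w * \int[mu]_x (g x * f x - y * g x).
  rewrite RintegralB// RintegralZl// mulrBr; congr (_ - _).
  by rewrite mulrCA g1 mulr1.
rewrite normrM ger0_norm// EFinM lee_wpmul2l ?lee_fin//.
have id : mu.-integrable [set: T] (EFin \o (fun x => g x * f x - y * g x)).
  exact: (integrableB measurableT igf igy).
rewrite EFin_normr_Rintegral//.
apply: (le_trans (le_abse_integral _ _ _)) => //; first exact: measurable_int id.
rewrite le_eqVlt; apply/orP; left; apply/eqP; apply: eq_integral => x _ /=.
by rewrite -EFinM -normrM (mulrC y) -mulrBr.
Qed.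
End averages.

(** The same for a sum against a partition of unity [q]. Its terms may have
    either sign, hence the absolute values on the right. *)
Lemma sumZ_average_le {R : realType} (q c : int -> R) (y : R) :
  is_cvg_sumZ q -> sumZ q = 1 ->
  (\esum_(k in [set: int]) `|q k|%:E < +oo)%E ->
  (\esum_(k in [set: int]) `|q k * c k|%:E < +oo)%E ->
  (`|sumZ (fun k => q k * c k) - y|%:E <=
   \esum_(k in [set: int]) (`|q k|%:E * `|c k - y|%:E))%E.
Proof.
move=> cq q1 qoo qcoo; have [cqc _] := sumZ_abs_le qcoo.
have -> : sumZ (fun k => q k * c k) - y =
    sumZ (fun k => q k * c k) - y * sumZ q by rewrite q1 mulr1.
rewrite sumZB_scale//.
have E k : `|q k * c k - y * q k| = `|q k| * `|c k - y|.
  by rewrite -normrM (mulrC y) -mulrBr.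
have oo : (\esum_(k in [set: int]) `|q k * c k - y * q k|%:E < +oo)%E.
  apply: (@le_lt_trans _ _ (\esum_(k in [set: int]) `|q k * c k|%:E +
     `|y|%:E * \esum_(k in [set: int]) `|q k|%:E)%E).
    rewrite -esumZl// -esumD//.
    by apply: le_esum => k _; rewrite -EFinM -EFinD lee_fin -normrM ler_normB.
  by rewrite lte_add_pinfty// lte_mul_pinfty ?lee_fin.
have [_ h] := sumZ_abs_le oo.
by apply: (le_trans h); apply: le_esum => k _; rewrite E EFinM.
Qed.

Section average_power.
Context d (T : measurableType d) (R : realType).
Variable mu : {measure set T -> \bar R}.
Variables (p Ma Ab : R) (alpha : int -> R) (b : T -> R) (g : int -> T -> R).
Hypotheses (p1 : 1 <= p) (Ab0 : 0 <= Ab).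
Hypothesis alpha0 : forall k, 0 <= alpha k.
Hypothesis alphaM : (\esum_(k in [set: int]) (alpha k)%:E <= Ma%:E)%E.
Hypotheses (mb : measurable_fun [set: T] b) (b0 : forall x, 0 <= b x).
Hypothesis intB : (\int[mu]_x (b x)%:E <= Ab%:E)%E.
Hypotheses (mg : forall k, measurable_fun [set: T] (g k))
  (g0 : forall k x, 0 <= g k x).

Lemma average_le_add_powR (s : R) : 0 < s ->
  (\esum_(k in [set: int]) ((alpha k)%:E * \int[mu]_v ((b v)%:E * (g k v)%:E)) <=
   (s * (Ma * Ab))%:E + (s `^ (1 - p))%:E *
     \esum_(k in [set: int])
       ((alpha k)%:E * \int[mu]_v ((b v)%:E * (g k v `^ p)%:E)))%E.
Proof.
move=> s0; have sp0 : 0 <= s `^ (1 - p) by exact: powR_ge0.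
have mbE : measurable_fun [set: T] (fun x => (b x)%:E) by exact/measurable_EFinP.
have bE0 x : (0 <= (b x)%:E)%E by rewrite lee_fin.
have mgp k : measurable_fun [set: T] (fun v => (b v)%:E * (g k v `^ p)%:E)%E.
  apply: emeasurable_funM => //; apply/measurable_EFinP.
  exact: (measurableT_comp (measurable_powR p) (mg k)).
have gp0 k v : (0 <= (b v)%:E * (g k v `^ p)%:E)%E.
  by rewrite mule_ge0// lee_fin powR_ge0.
have I0 k : (0 <= \int[mu]_v ((b v)%:E * (g k v `^ p)%:E))%E by exact: integral_ge0.
have inner k : (\int[mu]_v ((b v)%:E * (g k v)%:E) <=
    (s * Ab)%:E + (s `^ (1 - p))%:E * \int[mu]_v ((b v)%:E * (g k v `^ p)%:E))%E.
  apply: (@le_trans _ _ (s%:E * \int[mu]_v (b v)%:E + (s `^ (1 - p))%:E *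
      \int[mu]_v ((b v)%:E * (g k v `^ p)%:E))%E); last first.
    by apply: leeD => //; rewrite EFinM lee_wpmul2l// lee_fin ltW.
  rewrite -ge0_integralZl_EFin ?(ltW s0)// -ge0_integralZl_EFin//.
  rewrite -ge0_integralD//; last 4 first.
  - by move=> v _; rewrite mule_ge0// lee_fin ltW.
  - by apply: emeasurable_funM => //; exact: measurable_cst.
  - by move=> v _; rewrite mule_ge0// lee_fin.
  - by apply: emeasurable_funM => //; exact: measurable_cst.
  apply: le_ge0_integral => v; first by rewrite mule_ge0// lee_fin.
  rewrite -!EFinM -EFinD lee_fin.
  apply: (@le_trans _ _ (b v * (s + s `^ (1 - p) * g k v `^ p))).
    by rewrite ler_wpM2l// le_add_powR.
  by rewrite le_eqVlt; apply/orP; left; apply/eqP; ring.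
apply: (@le_trans _ _ (\esum_(k in [set: int]) ((s * Ab)%:E * (alpha k)%:E +
   (s `^ (1 - p))%:E *
       ((alpha k)%:E * \int[mu]_v ((b v)%:E * (g k v `^ p)%:E))))%E).
  apply: le_esum => k _.
  apply: (le_trans (lee_wpmul2l _ (inner k))); first by rewrite lee_fin.
  rewrite ge0_muleDr ?mule_ge0 ?lee_fin ?mulr_ge0 ?(ltW s0)//.
  by rewrite muleC leeD2l// muleCA.
have sAb0 : 0 <= s * Ab by rewrite mulr_ge0// ltW.
have aI0 k : (0 <= (alpha k)%:E * \int[mu]_v ((b v)%:E * (g k v `^ p)%:E))%E.
  by rewrite mule_ge0// lee_fin.
rewrite esumD; last 2 first.
- by move=> k _; rewrite -EFinM lee_fin mulr_ge0.
- by move=> k _; rewrite mule_ge0// lee_fin.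
rewrite !esumZl//.
apply: leeD => //.
apply: (le_trans (lee_wpmul2l _ alphaM)); first by rewrite lee_fin.
by rewrite -EFinM lee_fin le_eqVlt; apply/orP; left; apply/eqP; ring.
Qed.
End average_power.

(** Integrating the pointwise bound over [x]: for each [k] the substitution
    [x = node w k t] turns [a (pre k x)] into [a t] and produces the factor
    [1 / w] of the energy. *)
Section integral_average.
Context d (T : measurableType d) (R : realType).
Variable mu : {sigma_finite_measure set T -> \bar R}.
Variables (node : R -> int -> T -> T) (pre : int -> T -> T) (w p : R).
Variables (a b : T -> \bar R) (f : T -> R).
Hypotheses (w0 : 0 < w) (mnode : forall k, measurable_fun [set: T] (node w k)).
Hypothesis mpre : forall k, measurable_fun [set: T] (pre k).
Hypothesis preK : forall k, cancel (node w k) (pre k).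
Hypothesis ge0_integral_node : forall k (F : T -> \bar R),
  measurable_fun [set: T] F -> (forall x, 0 <= F x)%E ->
  (\int[mu]_x F (node w k x) = w%:E * \int[mu]_x F x)%E.
Hypotheses (ma : measurable_fun [set: T] a) (a0 : forall x, (0 <= a x)%E).
Hypotheses (mb : measurable_fun [set: T] b) (b0 : forall x, (0 <= b x)%E).
Hypothesis mf : measurable_fun [set: T] f.

Let H (k : int) (x v : T) := `|f (node w k v) - f x| `^ p.

Let mH : jointly_measurable H.
Proof.
move=> k; apply: measurable_powR_norm; apply: measurable_funB.
- have mfk := measurableT_comp mf (mnode k).
  exact: (measurableT_comp mfk measurable_snd).
- exact: (measurableT_comp mf measurable_fst).
Qed.

Let H0 k t v : 0 <= H k t v. Proof. exact: powR_ge0. Qed.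

Let F k x := (a (pre k x) * \int[mu]_v (b v * (H k x v)%:E))%E.

Let F0 k x : (0 <= F k x)%E.
Proof.
rewrite mule_ge0//; apply: integral_ge0 => v _.
by rewrite mule_ge0// lee_fin.
Qed.

Let mF k : measurable_fun [set: T] (F k).
Proof.
apply: emeasurable_funM; first exact: (measurableT_comp ma (mpre k)).
exact: (measurable_inner mu mb b0 mH (H0 k)).
Qed.

Lemma measurable_average : measurable_fun [set: T]
  (fun x => \esum_(k in [set: int]) (a (pre k x) *
     \int[mu]_v (b v * (`|f (node w k v) - f x| `^ p)%:E)))%E.
Proof. exact: measurable_esum_int mF F0. Qed.

Lemma integral_average_osc :
  (\int[mu]_x (\esum_(k in [set: int]) (a (pre k x) *
     \int[mu]_v (b v * (`|f (node w k v) - f x| `^ p)%:E))) =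
   osc mu node p a b f w)%E.
Proof.
rewrite -[LHS]/(\int[mu]_x (\esum_(k in [set: int]) F k x))%E.
rewrite ge0_integral_esum_int// /osc /energy -esumZl; last 2 first.
- by rewrite invr_ge0 ltW.
- move=> k; apply: integral_ge0 => t _; rewrite mule_ge0//.
  apply: integral_ge0 => v _; rewrite mule_ge0// lee_fin; exact: powR_ge0.
apply: eq_esum => k _.
have Fnode t : F k (node w k t) = (a t * \int[mu]_v (b v * (incr node p f w k t v)%:E))%E.
  by rewrite /F (preK k t).
have I : (\int[mu]_t (a t * \int[mu]_v (b v * (incr node p f w k t v)%:E)) =
    w%:E * \int[mu]_x F k x)%E.
  rewrite -(ge0_integral_node k (mF k) (F0 k)).
  by apply: eq_integral => t _; exact/esym/Fnode.
transitivity (w^-1%:E * (w%:E * \int[mu]_x F k x))%E.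
  by rewrite muleA -EFinM mulVf ?mul1e// gt_eqF.
exact: (congr1 (fun z => w^-1%:E * z)%E (esym I)).
Qed.
End integral_average.

(** The operator over an abstract space: [pre k x] plays the part of
    [w x - k]. *)
Section abstract_sampling_series.
Context d (T : measurableType d) (R : realType).
Variable mu : {sigma_finite_measure set T -> \bar R}.
Variables (node : R -> int -> T -> T) (pre : int -> T -> T) (w p : R).
Hypotheses (w0 : 0 < w) (p1 : 1 <= p).
Hypothesis mnode : forall k, measurable_fun [set: T] (node w k).
Hypothesis mpre : forall k, measurable_fun [set: T] (pre k).
Hypothesis nodeK : forall k, cancel (node w k) (pre k).
Hypothesis ge0_integral_node : forall k (F : T -> \bar R),
  measurable_fun [set: T] F -> (forall x, 0 <= F x)%E ->
  (\int[mu]_x F (node w k x) = w%:E * \int[mu]_x F x)%E.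
Variables (phi psi f : T -> R) (Mphi Mpsi Apsi : R).
Hypotheses (mphi : measurable_fun [set: T] phi) (mf : measurable_fun [set: T] f).
Hypothesis ipsi : mu.-integrable [set: T] (EFin \o psi).
Hypothesis psi1 : \int[mu]_x psi x = 1.
Hypothesis intpsi : (\int[mu]_x (`|psi x|)%:E <= Apsi%:E)%E.
Hypothesis phiM : forall x,
  (\esum_(k in [set: int]) (`|phi (pre k x)|)%:E <= Mphi%:E)%E.
Hypothesis phi_partition : forall x, is_cvg_sumZ (fun k => phi (pre k x)) /\
  sumZ (fun k => phi (pre k x)) = 1.
Hypothesis psiM : forall x, `|psi x| <= Mpsi.
Hypothesis foo : (\int[mu]_x (`|f x| `^ p)%:E < +oo)%E.

Let mpsi : measurable_fun [set: T] psi.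
Proof. by apply/measurable_EFinP; exact: measurable_int ipsi. Qed.

Let mEpsi : measurable_fun [set: T] (fun x => (`|psi x|)%:E).
Proof. by apply/measurable_EFinP; exact: measurableT_comp. Qed.

Let Apsi0 : 0 <= Apsi.
Proof. by rewrite -lee_fin (le_trans _ intpsi)// integral_ge0. Qed.

Let Mphi0 : 0 <= Mphi.
Proof. by rewrite -lee_fin (le_trans _ (phiM point))//; apply: esum_ge0. Qed.

Let Mpsi0 : 0 <= Mpsi.
Proof. by rewrite (le_trans _ (psiM point)). Qed.

Lemma ge0_integral_pre k (F : T -> \bar R) :
  measurable_fun [set: T] F -> (forall x, 0 <= F x)%E ->
  (\int[mu]_x F (pre k x) = w^-1%:E * \int[mu]_x F x)%E.
Proof.
move=> mF F0.
have mFp : measurable_fun [set: T] (fun x => F (pre k x)).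
  exact: (measurableT_comp mF (mpre k)).
have := @ge0_integral_node k (fun x => F (pre k x)) mFp (fun x => F0 (pre k x)).
have -> : (\int[mu]_x F (pre k (node w k x)) = \int[mu]_x F x)%E.
  by apply: eq_integral => x _; rewrite nodeK.
by move=> ->; rewrite muleA -EFinM mulVf ?mul1e// gt_eqF.
Qed.

Lemma integrable_pre k : mu.-integrable [set: T] (EFin \o (fun u => psi (pre k u))).
Proof.
apply/integrableP; split.
  by apply/measurable_EFinP; exact: (measurableT_comp mpsi (mpre k)).
have -> : (\int[mu]_x `|(EFin \o (fun u => psi (pre k u))) x| =
    w^-1%:E * \int[mu]_x (`|psi x|)%:E)%E.
  exact: (ge0_integral_pre k mEpsi).
apply: (@le_lt_trans _ _ (w^-1%:E * Apsi%:E)%E); last by rewrite -EFinM ltry.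
by rewrite lee_wpmul2l// lee_fin invr_ge0 ltW.
Qed.

Lemma Rintegral_pre k : w * \int[mu]_u psi (pre k u) = 1.
Proof.
have mp : measurable_fun [set: T] (fun x => (EFin \o psi)^\+ x)%E.
  by apply: measurable_funepos; exact/measurable_EFinP.
have mn : measurable_fun [set: T] (fun x => (EFin \o psi)^\- x)%E.
  by apply: measurable_funeneg; exact/measurable_EFinP.
have E : (\int[mu]_u (psi (pre k u))%:E = w^-1%:E * \int[mu]_u (psi u)%:E)%E.
  rewrite integralE [in RHS]integralE.
  have := ge0_integral_pre k mp (fun x => funepos_ge0 _ x).
  have := ge0_integral_pre k mn (fun x => funeneg_ge0 _ x).
  move=> hn hp.
  rewrite muleBr//; last exact: integrable_add_def.
  by congr (_ - _)%E; [move: hp|move: hn] => <-;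
    apply: eq_integral => x _; rewrite ?funeposE ?funenegE.
have psi1E : (\int[mu]_u (psi u)%:E = 1%:E)%E.
  by rewrite -psi1 /Rintegral fineK//; exact: integrable_fin_num ipsi.
by rewrite /Rintegral E psi1E -EFinM/= mulr1 mulfV// gt_eqF.
Qed.

Lemma measurable_pre_mul k : measurable_fun [set: T] (fun u => psi (pre k u) * f u).
Proof.
by apply: measurable_funM => //; exact: (measurableT_comp mpsi (mpre k)).
Qed.

Lemma integral_pre_mul_le k : (\int[mu]_u (`|psi (pre k u) * f u|)%:E <=
  (w^-1 * Apsi)%:E + Mpsi%:E * \int[mu]_x (`|f x| `^ p)%:E)%E.
Proof.
have mpk : measurable_fun [set: T] (fun u => psi (pre k u)).
  exact: (measurableT_comp mpsi (mpre k)).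
have := integral_norm_mul_le mu p1 Mpsi0 mf mpk (fun x => psiM (pre k x)).
move=> /le_trans; apply; apply: leeD => //.
have -> : (\int[mu]_x (`|psi (pre k x)|)%:E = w^-1%:E * \int[mu]_x (`|psi x|)%:E)%E.
  exact: (ge0_integral_pre k mEpsi).
by rewrite EFinM lee_wpmul2l// lee_fin invr_ge0 ltW.
Qed.

Lemma integrable_pre_mul k :
  mu.-integrable [set: T] (fun u => (psi (pre k u) * f u)%:E).
Proof.
apply/integrableP; split; first by apply/measurable_EFinP; exact: measurable_pre_mul.
apply: (le_lt_trans (integral_pre_mul_le k)).
by rewrite lte_add_pinfty ?ltry// lte_mul_pinfty ?lee_fin.
Qed.

Definition sample k := w * \int[mu]_u (psi (pre k u) * f u).

(** A bound that does not depend on [k] makes the series converge absolutely,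
    since [phi] has absolutely summable translates. *)
Lemma sample_bounded : exists2 K, 0 <= K & forall k, `|sample k| <= K.
Proof.
pose I := fine (\int[mu]_x (`|f x| `^ p)%:E)%E.
have Ifin : (\int[mu]_x (`|f x| `^ p)%:E)%E \is a fin_num.
  by rewrite ge0_fin_numE// integral_ge0// => x _; rewrite lee_fin powR_ge0.
have I0 : 0 <= I.
  by apply: fine_ge0; apply: integral_ge0 => x _; rewrite lee_fin powR_ge0.
exists (w * (w^-1 * Apsi + Mpsi * I)).
  by rewrite mulr_ge0 ?(ltW w0)// addr_ge0// mulr_ge0// invr_ge0 ltW.
move=> k; rewrite /sample normrM (gtr0_norm w0) ler_pM2l//.
rewrite -lee_fin EFin_normr_Rintegral//; last exact: integrable_pre_mul.
have ip := integrable_pre_mul k.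
have := le_abse_integral mu measurableT (measurable_int mu ip).
move=> /le_trans; apply.
apply: (le_trans (integral_pre_mul_le k)).
by rewrite EFinD (EFinM Mpsi) /I fineK.
Qed.

Lemma esum_phi_sample_lty x :
  (\esum_(k in [set: int]) (`|phi (pre k x) * sample k|)%:E < +oo)%E.
Proof.
have [K K0 cK] := sample_bounded.
apply: (@le_lt_trans _ _ (K%:E * \esum_(k in [set: int]) (`|phi (pre k x)|)%:E)%E).
  rewrite -esumZl//; apply: le_esum => k _.
  by rewrite -EFinM lee_fin normrM mulrC ler_wpM2r.
by rewrite lte_mul_pinfty ?lee_fin// (le_lt_trans (phiM x))// ltry.
Qed.

Definition sampling_series x := sumZ (fun k => phi (pre k x) * sample k).

Lemma is_cvg_sampling_series x : is_cvg_sumZ (fun k => phi (pre k x) * sample k).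
Proof. by have [] := sumZ_abs_le (esum_phi_sample_lty x). Qed.

Lemma sample_sub_le k y : ((`|sample k - y|)%:E <=
  \int[mu]_v (`|psi v|%:E * (`|f (node w k v) - y|)%:E))%E.
Proof.
have := Rintegral_sub_scaled_le y (ltW w0) (integrable_pre k)
  (integrable_pre_mul k) (Rintegral_pre k).
move=> /le_trans; apply.
pose F u := (`|psi (pre k u)|%:E * (`|f u - y|)%:E)%E.
have mF : measurable_fun [set: T] F.
  apply: emeasurable_funM.
    exact: (measurableT_comp mEpsi (mpre k)).
  apply/measurable_EFinP; apply: measurableT_comp => //.
  exact: measurable_funB.
have F0 u : (0 <= F u)%E by rewrite mule_ge0.
rewrite -(ge0_integral_node k mF F0) le_eqVlt; apply/orP; left; apply/eqP.
by apply: eq_integral => v _; rewrite /F nodeK.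
Qed.

(** The constant of [powR_le_of_le_add]. The mass of the average is at most
    [Mphi * Apsi]; adding 1 makes it positive. *)
Definition power_const := (2 * (Mphi * Apsi + 1)) `^ (p - 1) * 2.

Definition average x : \bar R := (\esum_(k in [set: int]) (`|phi (pre k x)|%:E *
     \int[mu]_v (`|psi v|%:E * (`|f (node w k v) - f x| `^ p)%:E)))%E.

Lemma sampling_series_sub_powR_le x :
  ((`|sampling_series x - f x| `^ p)%:E <= power_const%:E * average x)%E.
Proof.
have C0 : 0 < Mphi * Apsi + 1 by rewrite ltr_wpDl// mulr_ge0.
have J0 : (0 <= average x)%E.
  apply: esum_ge0 => k _; rewrite mule_ge0//; apply: integral_ge0 => v _.
  by rewrite mule_ge0// lee_fin powR_ge0.
apply: (powR_le_of_le_add p1 C0 (normr_ge0 _) J0) => s s0.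
have [cphi phi1] := phi_partition x.
have phioo : (\esum_(k in [set: int]) (`|phi (pre k x)|)%:E < +oo)%E.
  by rewrite (le_lt_trans (phiM x))// ltry.
have := sumZ_average_le (f x) cphi phi1 phioo (esum_phi_sample_lty x).
move=> /le_trans; apply.
apply: (@le_trans _ _ (\esum_(k in [set: int]) (`|phi (pre k x)|%:E *
     \int[mu]_v (`|psi v|%:E * (`|f (node w k v) - f x|)%:E)))%E).
  by apply: le_esum => k _; rewrite lee_wpmul2l//; exact: sample_sub_le.
have mg k : measurable_fun [set: T] (fun v => `|f (node w k v) - f x|).
  apply: measurableT_comp => //; apply: measurable_funB => //.
  exact: (measurableT_comp mf (mnode k)).
have mnpsi : measurable_fun [set: T] (fun x => `|psi x|) by exact: measurableT_comp.
have := average_le_add_powR p1 Apsi0 (fun k => normr_ge0 (phi (pre k x)))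
  (phiM x) mnpsi (fun x => normr_ge0 (psi x)) intpsi mg
  (fun k v => normr_ge0 (f (node w k v) - f x)) s0.
move=> /le_trans; apply; apply: leeD => //.
by rewrite lee_fin ler_pM2l// lerDl.
Qed.

Lemma integral_sampling_series_le :
  (\int[mu]_x (`|sampling_series x - f x| `^ p)%:E <= power_const%:E *
   osc mu node p (fun x => (`|phi x|)%:E) (fun x => (`|psi x|)%:E) f w)%E.
Proof.
have k0 : 0 <= power_const by rewrite mulr_ge0// powR_ge0.
have mEphi : measurable_fun [set: T] (fun x => (`|phi x|)%:E).
  by apply/measurable_EFinP; exact: measurableT_comp.
have e0 (h : T -> R) x : (0 <= (`|h x|)%:E)%E by rewrite lee_fin.
have J0 x : (0 <= average x)%E.
  apply: esum_ge0 => k _; rewrite mule_ge0//; apply: integral_ge0 => v _.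
  by rewrite mule_ge0// lee_fin powR_ge0.
have mJ : measurable_fun [set: T] average.
  exact: (measurable_average mu p mnode mpre mEphi (e0 phi) mEpsi (e0 psi) mf).
have I : (\int[mu]_x average x =
    osc mu node p (fun x => (`|phi x|)%:E) (fun x => (`|psi x|)%:E) f w)%E.
  exact: (integral_average_osc p w0 mnode mpre nodeK ge0_integral_node mEphi (e0 phi)
    mEpsi (e0 psi) mf).
rewrite -I -ge0_integralZl_EFin//; apply: le_ge0_integral => x.
  by rewrite lee_fin powR_ge0.
exact: sampling_series_sub_powR_le.
Qed.
End abstract_sampling_series.

(** * Affine maps and Lebesgue measure *)

(** The completed Lebesgue measure, bundled on the line equipped with its own
    sigma-algebra. Naming the type keeps unification from unfolding the
    construction of that sigma-algebra. *)
Definition lebT (R : realType) : measurableType _ :=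
  caratheodory_type [the outer_measure _ _ of mu_ext (wlength (@idfun R))].
Definition lebm (R : realType) : {sigma_finite_measure set (lebT R) -> \bar R} :=
  leb R.

Section affine.
Context {R : realType}.
Implicit Types (a b : R) (A : set R).

Lemma wlength_affine a b A : 0 < a -> ocitv A ->
  ocitv ((fun x => a * x + b) @^-1` A) /\
  (wlength idfun ((fun x => a * x + b)%R @^-1` A) = a^-1%:E * wlength idfun A)%E.
Proof.
move=> a0 [[x y] _ <-] /=.
have -> : (fun z => a * z + b) @^-1` `]x, y] = `](x - b) / a, (y - b) / a]%classic.
  apply/seteqP; split => z /=; rewrite !in_itv/= ltr_pdivrMr// ler_pdivlMr//;
  by rewrite ltrBlDr lerBrDr mulrC.
split; first exact: is_ocitv.
rewrite !wlength_itv /= !lte_fin ltr_pM2r ?invr_gt0// ltrD2r.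
case: ifPn => _; last by rewrite mule0.
rewrite -!EFinD -EFinM; congr (_%:E); by field; rewrite gt_eqF.
Qed.

(** Affine maps carry covers by intervals to covers by intervals and rescale
    their lengths; so the outer measure scales. The converse inequality is the
    same statement for the inverse map. *)
Lemma le_lebm_affine a b A : 0 < a ->
  (lebm R ((fun x => a * x + b)%R @^-1` A) <= a^-1%:E * lebm R A)%E.
Proof.
move=> a0; have ai0 : 0 < a^-1 by rewrite invr_gt0.
rewrite muleC -lee_pdivrMr//.
apply: le_ereal_inf_tmp => _ [F [mF AF] <-].
rewrite lee_pdivrMr// muleC -nneseriesZl; last by move=> i _; exact: measure_ge0.
apply: ereal_inf_lbound; exists (fun n => (fun x => a * x + b) @^-1` (F n)).
  split; first by move=> i; exact: (wlength_affine b a0 (mF i)).1.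
  by move=> x /AF[n _ Fn]; exists n.
apply: eq_eseriesr => n _; exact: (wlength_affine b a0 (mF n)).2.
Qed.

Definition affine a b : lebT R -> lebT R := fun x => a * (x : R) + b.

Lemma affineK a b : 0 < a -> cancel (affine a b) (affine a^-1 (- (b / a))).
Proof.
move=> a0 x; have key (y : R) : a^-1 * (a * y + b) + - (b / a) = y.
  by field; rewrite gt_eqF.
exact: key.
Qed.

Lemma affineKV a b : 0 < a -> cancel (affine a^-1 (- (b / a))) (affine a b).
Proof.
move=> a0 x; have key (y : R) : a * (a^-1 * y + - (b / a)) + b = y.
  by field; rewrite gt_eqF.
exact: key.
Qed.

Lemma lebm_affine a b A : 0 < a ->
  lebm R (affine a b @^-1` A) = (a^-1%:E * lebm R A)%E.
Proof.
move=> a0; apply/eqP; rewrite eq_le le_lebm_affine//=.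
rewrite muleC lee_pdivrMr//.
rewrite -[in leLHS](_ : affine a^-1 (- (b / a)) @^-1` (affine a b @^-1` A) = A).
  by rewrite muleC -[in a%:E](invrK a) le_lebm_affine ?invr_gt0.
by apply/seteqP; split => x /=; rewrite affineKV.
Qed.

(** Lebesgue sets need not be Borel, so this does not follow from continuity.
    But the condition of Caratheodory only refers to the outer measure, which
    scales. *)
Lemma measurable_affine a b : 0 < a ->
  measurable_fun [set: lebT R] (affine a b).
Proof.
move=> a0 _ A mA; rewrite setTI.
have cA X : lebm R X = (lebm R (X `&` A) + lebm R (X `&` ~` A))%E := mA X.
suff cB X : lebm R X =
  (lebm R (X `&` affine a b @^-1` A) + lebm R (X `&` ~` (affine a b @^-1` A)))%E.
  exact: cB.
have XE : X = affine a b @^-1` (affine a^-1 (- (b / a)) @^-1` X).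
  by apply/seteqP; split => x /=; rewrite affineK.
rewrite XE preimage_setC -!preimage_setI !(lebm_affine b)// -ge0_muleDr ?measure_ge0//.
by rewrite -cA.
Qed.

Lemma ge0_integral_affine a b (f : lebT R -> \bar R) : 0 < a ->
  measurable_fun [set: lebT R] f -> (forall x, 0 <= f x)%E ->
  (\int[lebm R]_x f (affine a b x) = a^-1%:E * \int[lebm R]_x f x)%E.
Proof.
move=> a0 mf f0.
have ma := @measurable_affine a b a0.
have ai : (0 <= a^-1) by rewrite invr_ge0 ltW.
rewrite -[LHS](@ge0_integral_pushforward _ _ _ _ R _ ma (lebm R) setT f)//.
transitivity (\int[mscale (NngNum ai) (lebm R)]_x f x)%E; last first.
  by rewrite ge0_integral_mscale.
apply: eq_measure_integral => A mA _ /=.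
by rewrite /pushforward /mscale/= -[LHS]/(lebm R (affine a b @^-1` A)) lebm_affine.
Qed.
End affine.

(** The nodes of the sampling operator: [node w k x = (x + k) / w], with
    inverse [shrink w k x = w x - k]. *)
Section nodes.
Local Open Scope ereal_scope.
Context {R : realType}.
Notation T := (lebT R).
Notation mu := (lebm R).

Definition shrink (w : R) (k : int) : T -> T := affine w (- k%:~R).

Definition node (w : R) (k : int) : T -> T := affine w^-1 (k%:~R / w).

Lemma nodeK w k : (0 < w)%R -> cancel (node w k) (shrink w k).
Proof.
move=> w0 x; rewrite /node /affine /shrink /affine.
have key (y : R) : (w * (w^-1 * y + k%:~R / w) + - k%:~R = y)%R.
  by field; rewrite gt_eqF.
exact: key.
Qed.

Lemma measurable_node w k : (0 < w)%R -> measurable_fun [set: T] (node w k).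
Proof. by move=> w0; apply: measurable_affine; rewrite invr_gt0. Qed.

Lemma measurable_shrink w k : (0 < w)%R -> measurable_fun [set: T] (shrink w k).
Proof. by move=> w0; exact: measurable_affine. Qed.

Lemma ge0_integral_node w k (F : T -> \bar R) : (0 < w)%R ->
  measurable_fun [set: T] F -> (forall x, 0 <= F x) ->
  \int[mu]_x F (node w k x) = w%:E * \int[mu]_x F x.
Proof.
by move=> w0 mF F0; rewrite ge0_integral_affine ?invrK ?invr_gt0.
Qed.


Lemma esum_node_le (b : T -> \bar R) (Mb w : R) (g : T -> R) :
  measurable_fun [set: T] b -> (forall x, 0 <= b x) ->
  (forall u : R, \esum_(k in [set: int]) b (u - k%:~R)%R <= Mb%:E) ->
  (0 < w)%R ->
  measurable_fun [set: T] g -> (forall x, 0 <= g x)%R ->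
  \esum_(k in [set: int]) \int[mu]_v (b v * (g (node w k v))%:E) <=
  (w * Mb)%:E * \int[mu]_u (g u)%:E.
Proof.
move=> mb b0 bM w0 mg g0.
have mpre k : measurable_fun [set: T] (shrink w k) by exact: measurable_shrink.
have nK k : cancel (node w k) (shrink w k) by exact: nodeK.
have bM' (u : T) : \esum_(k in [set: int]) b (shrink w k u) <= Mb%:E.
  exact: (bM (w * (u : R))%R).
exact: (esum_integral_node_le w0 mpre nK
  (fun k F => @ge0_integral_node w k F w0) mb b0 bM' mg g0).
Qed.
End nodes.

(** * Counting the nodes in an interval *)
Section counting.
Context {R : realType}.
Implicit Types c d w t v x : R.

(** The integers in [ ]l, r] ] are those in [ ]floor l, floor r] ]. *)
Lemma esum_int_count (l r : R) : l <= r ->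
  (\esum_(k in [set: int]) ((l < k%:~R <= r)%R%:R)%:E <= (r - l + 1)%:E :> \bar R)%E.
Proof.
move=> lr; set m := Num.floor l; set M := Num.floor r.
have mM : m <= M by exact: le_floor.
pose e (i : nat) : int := m + 1 + i%:Z.
have einj : set_inj `I_(`|M - m|)%N e.
  by move=> i j _ _ /addrI [].
apply: (@le_trans _ _ (\esum_(k in e @` `I_(`|M - m|)%N) 1)%E).
  rewrite [leRHS]esum_mkcond; apply: le_esum => k _.
  have [kI|kI] := boolP (k \in _); first by case: (_ < _ <= _); rewrite lee_fin.
  suff /negbTE -> : ~~ (l < k%:~R <= r) by [].
  rewrite -floor_lt_int -floor_ge_int -/m -/M.
  apply: contraNN kI => /andP[mk kM]; rewrite inE.
  exists (absz ((k : int) - (m + 1))%R); rewrite /= /e; lia.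
rewrite esum_image// esum_fset//.
rewrite -fsbig_ord sumEFin lee_fin big_const_ord iter_addr_0.
have -> : 1 *+ `|M - m|%N = (M - m)%:~R :> R.
  by rewrite -[in RHS](gez0_abs (m := M - m)) ?subr_ge0.
have := floor_le r; have := floorD1_gt l.
rewrite -/m -/M !intrD intrN => ? ?; lra.
Qed.

Lemma norm_bool_powR (p : R) (b1 b2 : bool) : p != 0 ->
  `|b1%:R - b2%:R| `^ p = (b1 (+) b2)%:R :> R.
Proof.
move=> p0; case: b1; case: b2; rewrite /= ?subrr ?subr0 ?sub0r ?normrN ?normr0 ?normr1.
all: by rewrite ?(powR0 p0) ?powR1.
Qed.

(** Membership in [ ]c, d] ] can only change if one crosses [c] or [d]. *)
Lemma itv_xor_le c d x y : c <= d ->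
  ((c < x <= d) (+) (c < y <= d))%:R <=
  ((c < x) (+) (c < y))%:R + ((d < x) (+) (d < y))%:R :> R.
Proof.
move=> cd; rewrite !(leNgt _ d).
have [cx|cx] := ltP c x; have [cy|cy] := ltP c y => /=.
- by case: (d < x); case: (d < y) => /=; lra.
- by rewrite (ltNge d y) (le_trans cy cd)/=; case: (d < x) => /=; lra.
- by rewrite (ltNge d x) (le_trans cx cd)/=; case: (d < y) => /=; lra.
- by rewrite (ltNge d x) (ltNge d y) (le_trans cx cd) (le_trans cy cd) /=; lra.
Qed.

Let nodeR w (k : int) x : R := w^-1 * x + k%:~R / w.

Lemma lt_nodeE w k c x : 0 < w -> (c < nodeR w k x) = (c * w - x < k%:~R).
Proof.
move=> w0; rewrite /nodeR (mulrC w^-1) -mulrDl ltr_pdivlMr//.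
by rewrite ltrBlDl.
Qed.

(** The two [k]-th nodes lie on different sides of [c] exactly when [k] lies
    between [c w - v] and [c w - t], an interval whose length does not depend
    on [w]. *)
Lemma count_cross w c t v : 0 < w ->
  (\esum_(k in [set: int])
    (((c < nodeR w k v) (+) (c < nodeR w k t))%R%:R)%:E <= (`|v - t| + 1)%:E)%E.
Proof.
move=> w0; wlog tv : t v / t <= v => [hw|].
  have [tv|/ltW vt] := leP t v; first exact: hw.
  by rewrite distrC; under eq_esum do rewrite addbC; exact: hw.
rewrite ger0_norm ?subr_ge0//.
have -> : v - t = (c * w - t) - (c * w - v) by ring.
apply: le_trans (esum_int_count _); last by rewrite lerD2l lerN2.
apply: le_esum => k _; rewrite !lt_nodeE// lee_fin.
rewrite (leNgt k%:~R).
have [h1|h1] := ltP (c * w - v) k%:~R => //=.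
rewrite ltNge (le_trans h1)//=.
by rewrite lerD2l lerN2.
Qed.

Lemma count_itv w c d t : 0 < w -> c <= d ->
  (\esum_(k in [set: int]) ((c < nodeR w k t <= d)%R%:R)%:E <=
    ((d - c) * w + 1)%:E)%E.
Proof.
move=> w0 cd; have -> : (d - c) * w = (d * w - t) - (c * w - t) by ring.
apply: le_trans (esum_int_count _); last by rewrite lerD2r ler_pM2r.
by apply: le_esum => k _; rewrite (leNgt _ d) !lt_nodeE// -leNgt.
Qed.

End counting.

(** * Vanishing oscillation on the line *)
Lemma measurable_borel_lebT {R : realType} (A : set R) :
  measurable A -> measurable (A : set (lebT R)).
Proof. exact: sub_caratheodory. Qed.

Section far.
Context {R : realType}.
Notation T := (lebT R).
Notation mu := (lebm R).

Definition far (N : nat) : set T := [set x : T | N%:R < `|x : R|].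

Lemma measurable_far N : measurable (far N).
Proof.
apply: measurable_borel_lebT; rewrite /far.
have -> : [set x : R | N%:R < `|x|] = @Num.norm R R @^-1` `]N%:R, +oo[%classic.
  by apply/seteqP; split => x /=; rewrite in_itv/= andbT.
rewrite -[X in measurable X]setTI.
by apply: (@normr_measurable R setT) => //.
Qed.

Lemma near_not_far (x : T) : \forall n \near \oo, ~ far n x.
Proof.
near=> n; rewrite /far/=; apply/negP; rewrite -leNgt; near: n.
exact: nbhs_infty_ger.
Unshelve. all: by end_near. Qed.
End far.

Section cover_approximation.
Context d (T : measurableType d) (R : realType).
Variable mu : {measure set T -> \bar R}.

Lemma norm_indicB_powR_le (p : R) (A B U : set T) x : p != 0 ->
  A `<=` U -> B `<=` U ->
  `|\1_A x - \1_B x| `^ p <= \1_(U `\` A) x + \1_(U `\` B) x.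
Proof.
move=> p0 AU BU; rewrite !indicE norm_bool_powR// !in_setD.
have UA : x \in A -> x \in U by rewrite !inE; exact: AU.
have UB : x \in B -> x \in U by rewrite !inE; exact: BU.
rewrite -natrD ler_nat.
by case: (x \in A) UA => [/(_ isT) ->|_]; case: (x \in B) UB => // /(_ isT) ->.
Qed.

(** With [U] the union of the cover and [B] a finite part of it, both
    [U \ A] and [U \ B] are small: the first because the cover is almost
    optimal, the second because it is covered by a tail of the series. *)
Lemma finite_cover_approximation (p : R) (A : set T) (F : (set T)^nat) (e : R) :
  p != 0 -> measurable A -> (mu A < +oo)%E -> (forall n, measurable (F n)) ->
  A `<=` \bigcup_n F n -> 0 < e ->
  (\sum_(n <oo) mu (F n) <= mu A + e%:E)%E ->
  exists n, (\int[mu]_x (`|\1_A x - \1_(\big[setU/set0]_(i < n) F i) x| `^ p)%:E <=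
     (e + e)%:E)%E.
Proof.
move=> p0 mA Aoo mF AF e0 Fe; pose U := \bigcup_n F n.
have mU : measurable U by exact: bigcupT_measurable.
have Foo : (\sum_(n <oo) mu (F n) < +oo)%E.
  by apply: le_lt_trans Fe _; rewrite lte_add_pinfty// ltry.
have muU : (mu U <= \sum_(n <oo) mu (F n))%E.
  exact: measure_sigma_subadditive.
have UA : (mu (U `\` A) <= e%:E)%E.
  rewrite measureD//; last by rewrite (le_lt_trans muU).
  rewrite setIidr// leeBlDl//; last by rewrite ge0_fin_numE.
  exact: le_trans Fe.
have := nneseries_tail_cvg Foo (fun k _ => measure_ge0 mu (F k)).
move=> /fine_cvgP[fin0 /cvgr0Pnorm_le /(_ _ e0) le0].
have [n [fin_n le_n]] : exists n, (\sum_(n <= k <oo) mu (F k))%E \is a fin_num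
   /\ `|fine (\sum_(n <= k <oo) mu (F k))%E| <= e.
  have [N _ HN] := filterI fin0 le0.
  by exists N; exact: (HN N (leqnn N)).
exists n; set B := \big[setU/set0]_(i < n) F i.
have mB : measurable B by exact: bigsetU_measurable.
have BU : B `<=` U by exact: bigsetU_bigcup.
have UB : (mu (U `\` B) <= e%:E)%E.
  apply: (@le_trans _ _ (\sum_(n <= k <oo) mu (F k))%E).
    apply: measure_sigma_subadditive_tail => //; first exact: measurableD.
    move=> x [[k _ Fk] nB]; exists k => //= kn; apply: nB.
    by rewrite /B -bigcup_mkord; exists k.
  by rewrite -(fineK fin_n) lee_fin (le_trans (ler_norm _)).
have mUA : measurable (U `\` A) by exact: measurableD.
have mUB : measurable (U `\` B) by exact: measurableD.
apply: (@le_trans _ _ (\int[mu]_x ((\1_(U `\` A) x)%:E + (\1_(U `\` B) x)%:E))%E).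
  apply: le_ge0_integral => x; first by rewrite lee_fin powR_ge0.
  by rewrite -EFinD lee_fin norm_indicB_powR_le.
rewrite ge0_integralD//; last 2 first.
- by apply/measurable_EFinP; exact: measurable_indic.
- by apply/measurable_EFinP; exact: measurable_indic.
by rewrite !integral_indic// !setIT EFinD; exact: leeD.
Qed.
End cover_approximation.

Section vanishing_sets.
Context {R : realType}.
Notation T := (lebT R).
Notation mu := (lebm R).
Variables (p : R) (a b : T -> R) (Aa Ab Ma Mb : R).
Hypothesis p1 : 1 <= p.
Hypotheses (ma : measurable_fun [set: T] a) (a0 : forall x, 0 <= a x).
Hypotheses (mb : measurable_fun [set: T] b) (b0 : forall x, 0 <= b x).
Hypothesis intA : (\int[mu]_x (a x)%:E <= Aa%:E)%E.
Hypothesis intB : (\int[mu]_x (b x)%:E <= Ab%:E)%E.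
Hypothesis aM : forall u : R,
  (\esum_(k in [set: int]) (a (u - k%:~R)%R)%:E <= Ma%:E)%E.
Hypothesis bM : forall u : R,
  (\esum_(k in [set: int]) (b (u - k%:~R)%R)%:E <= Mb%:E)%E.

Notation vanish := (vanishing mu (@node R) p (EFin \o a) (EFin \o b)).

Let p0 : p != 0. Proof. by rewrite gt_eqF// (lt_le_trans ltr01). Qed.

Lemma incr_indic (A : set T) w k t v :
  incr (@node R) p \1_A w k t v =
  ((node w k v \in A) (+) (node w k t \in A))%:R.
Proof. by rewrite /incr !indicE norm_bool_powR. Qed.

Lemma incr_indic_itv (c d : R) w k (t v : T) : c <= d ->
  incr (@node R) p \1_(`]c, d]%classic : set T) w k t v <=
  ((c < (node w k v : R)) (+) (c < (node w k t : R)))%:R +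
  ((d < (node w k v : R)) (+) (d < (node w k t : R)))%:R.
Proof.
move=> cd; rewrite incr_indic.
have E (x : R) : (x \in (`]c, d]%classic : set R)) = (c < x <= d).
  by apply/idP/idP; rewrite inE /= in_itv.
rewrite !E; exact: itv_xor_le.
Qed.

Lemma incr_indic_itv_le (c d : R) w k (t v : T) :
  incr (@node R) p \1_(`]c, d]%classic : set T) w k t v <=
  (c < (node w k v : R) <= d)%R%:R + (c < (node w k t : R) <= d)%R%:R.
Proof.
rewrite incr_indic.
have E (x : R) : (x \in (`]c, d]%classic : set R)) = (c < x <= d).
  by apply/idP/idP; rewrite inE /= in_itv.
rewrite !E -natrD ler_nat; by case: (c < _ <= d); case: (c < _ <= d).
Qed.
Lemma measurable_ocitv_lebT (c d : R) :
  measurable (`]c, d]%classic : set T).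
Proof. by apply: measurable_borel_lebT; exact: measurable_itv. Qed.

(** The two counting bounds in the form required by [vanishing_count]. *)
Lemma vanishing_itv (c d : R) : c <= d -> vanish \1_(`]c, d]%classic : set T).
Proof.
move=> cd.
have mA : measurable_fun [set: T] (\1_(`]c, d]%classic : set T) : T -> R).
  exact: (measurable_indic (measurable_ocitv_lebT c d)).
have C0 : 0 <= 2 * (d - c) + 2 by lra.
have B0 (n : nat) : 0 <= 2 * (2 * n%:R + 1) :> R.
  by rewrite mulr_ge0// addr_ge0// mulr_ge0.
apply: (vanishing_count (@measurable_node R) ma a0 mb b0 intA intB
  measurable_far near_not_far mA C0 B0).
- move=> w t v w1; have w0 : 0 < w by exact: lt_le_trans w1.
  apply: (@le_trans _ _ (((d - c) * w + 1)%:E + ((d - c) * w + 1)%:E)%E); last first.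
    by rewrite -EFinD lee_fin; lra.
  apply: (le_trans _ (leeD (count_itv v w0 cd) (count_itv t w0 cd))).
  rewrite -esumD; last 2 first.
  + by move=> k _; rewrite lee_fin ler0n.
  + by move=> k _; rewrite lee_fin ler0n.
  by apply: le_esum => k _; rewrite -EFinD lee_fin; exact: incr_indic_itv_le.
(* both variables in [-n, n]: at most [2 n + 1] crossings at each end point *)
- move=> n w t v w0 /negP; rewrite -leNgt => tn /negP; rewrite -leNgt => vn.
  have vtn : `|(v : R) - (t : R)| <= 2 * n%:R.
    by rewrite (le_trans (ler_normB _ _))// mulr_natl mulr2n lerD.
  apply: (@le_trans _ _ ((`|(v : R) - (t : R)| + 1)%:E +
      (`|(v : R) - (t : R)| + 1)%:E)%E); last first.
    by rewrite -EFinD lee_fin; lra.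
  apply: (le_trans _ (leeD (count_cross c t v w0) (count_cross d t v w0))).
  rewrite -esumD; last 2 first.
  + by move=> k _; rewrite lee_fin ler0n.
  + by move=> k _; rewrite lee_fin ler0n.
  by apply: le_esum => k _; rewrite -EFinD lee_fin; exact: incr_indic_itv.
Qed.

Lemma vanishing_ocitv (A : set R) : ocitv A -> vanish \1_(A : set T).
Proof.
move=> [[c d] _ <-] /=; have [cd|dc] := leP c d; first exact: vanishing_itv.
have -> : `]c, d]%classic = `]c, c]%classic.
  by rewrite !set_itv_ge// bnd_simp ?lt_irreflexive// -leNgt ltW.
exact: vanishing_itv.
Qed.

Lemma vanishing_setU (A B : set T) : measurable A -> measurable B ->
  vanish \1_A -> vanish \1_B -> vanish \1_(A `|` B).
Proof.
move=> mA mB.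
have miA : measurable_fun [set: T] (\1_A : T -> R) by exact: measurable_indic.
have miB : measurable_fun [set: T] (\1_B : T -> R) by exact: measurable_indic.
have eb0 x : (0 <= (EFin \o b) x)%E by rewrite lee_fin.
have ea0 x : (0 <= (EFin \o a) x)%E by rewrite lee_fin.
have mea : measurable_fun [set: T] (EFin \o a) by exact/measurable_EFinP.
have meb : measurable_fun [set: T] (EFin \o b) by exact/measurable_EFinP.
apply: (vanishing_incr_le (@measurable_node R) mea ea0 meb eb0 miA miB).
move=> w k t v; rewrite !incr_indic !in_setU -natrD ler_nat.
by case: (_ \in A); case: (_ \in A); case: (_ \in B); case: (_ \in B).
Qed.

Lemma measurable_ocitv (A : set R) : ocitv A -> measurable (A : set T).
Proof. by move=> [[c d] _ <-]; exact: measurable_ocitv_lebT. Qed.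

Lemma vanishing_bigsetU (F : (set T)^nat) n : (forall i, @ocitv R (F i)) ->
  vanish \1_(\big[setU/set0]_(i < n) F i).
Proof.
move=> oF; elim: n => [|n IH].
  by rewrite big_ord0; apply: vanishing_ocitv; exact: ocitv0.
rewrite big_ord_recr /=; apply: vanishing_setU.
- by apply: bigsetU_measurable => i _; exact: measurable_ocitv.
- exact: measurable_ocitv.
- exact: IH.
- exact: vanishing_ocitv.
Qed.

(** The measure is an infimum over covers by half-open intervals. *)
Lemma lebm_cover (A : set T) (e : R) : (mu A < +oo)%E -> 0 < e ->
  exists F : (set T)^nat, [/\ forall n, @ocitv R (F n), A `<=` \bigcup_n F n &
    (\sum_(n <oo) mu (F n) <= mu A + e%:E)%E].
Proof.
move=> Aoo e0; have : mu A \is a fin_num by rewrite ge0_fin_numE.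
move=> /lb_ereal_inf_adherent => /(_ _ e0)[_/= [F [oF AF] <-] Fe].
exists F; split => //; apply: le_trans (ltW Fe).
rewrite le_eqVlt; apply/orP; left; apply/eqP; apply: eq_eseriesr => n _.
exact: (measurable_mu_extE _ (oF n)).
Qed.

Let ea0 x : (0 <= (EFin \o a) x)%E. Proof. by rewrite lee_fin. Qed.
Let eb0 x : (0 <= (EFin \o b) x)%E. Proof. by rewrite lee_fin. Qed.
Let mea : measurable_fun [set: T] (EFin \o a). Proof. exact/measurable_EFinP. Qed.
Let meb : measurable_fun [set: T] (EFin \o b). Proof. exact/measurable_EFinP. Qed.

Let Ma0 : 0 <= Ma.
Proof. by rewrite -lee_fin (le_trans _ (aM 0))//; apply: esum_ge0 => k _; rewrite lee_fin. Qed.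

Let Mb0 : 0 <= Mb.
Proof. by rewrite -lee_fin (le_trans _ (bM 0))//; apply: esum_ge0 => k _; rewrite lee_fin. Qed.

Let a_node w (g : T -> R) (w0 : 0 < w) := @esum_node_le R _ Ma w g mea ea0 aM w0.
Let b_node w (g : T -> R) (w0 : 0 < w) := @esum_node_le R _ Mb w g meb eb0 bM w0.

Let vanish_closed := @vanishing_closed _ T R mu (@node R) (@measurable_node R)
  p (EFin \o a) (EFin \o b) Aa Ab Ma Mb p1 mea ea0 meb eb0 Ma0 Mb0 intA intB
  a_node b_node.

Lemma vanishing_indic (A : set T) : measurable A -> (mu A < +oo)%E ->
  vanish \1_A.
Proof.
move=> mA Aoo; apply: vanish_closed; first exact: measurable_indic.
move=> e e0; have e20 : 0 < e / 2 by rewrite divr_gt0.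
have [F [oF AF Fe]] := lebm_cover Aoo e20.
have mF n : measurable (F n) by exact: measurable_ocitv.
have [n hn] := finite_cover_approximation p0 mA Aoo mF AF e20 Fe.
exists \1_(\big[setU/set0]_(i < n) F i); split.
- by apply: measurable_indic; apply: bigsetU_measurable.
- exact: vanishing_bigsetU.
- by rewrite [in leRHS](splitr e).
Qed.

Lemma vanishing_Lp (f : T -> R) : measurable_fun [set: T] f ->
  (\int[mu]_x (`|f x| `^ p)%:E < +oo)%E -> vanish f.
Proof.
have PD (g h : T -> R) : measurable_fun [set: T] g -> measurable_fun [set: T] h ->
    vanish g -> vanish h -> vanish (g \+ h).
  move=> mg mh.
  exact: (vanishingD (@measurable_node R) p1 mea ea0 meb eb0 mg mh).
have PZ (g : T -> R) c : measurable_fun [set: T] g -> vanish g ->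
    vanish (fun x => c * g x).
  move=> mg; exact: (vanishingZ (@measurable_node R) mea ea0 meb eb0 c mg).
exact: (Lp_induction p1 vanishing_indic PD PZ vanish_closed).
Qed.
End vanishing_sets.

(** * Kernels and moments *)
Section moments.
Context {R : realType}.
Implicit Types (g : R -> R) (r : R).

Lemma moment_bound r g : (moment r g < +oo)%E -> exists2 M, 0 <= M &
  forall u, (\esum_(k in [set: int])
    (`|g (u - k%:~R)| * `|u - k%:~R| `^ r)%:E <= M%:E)%E.
Proof.
move=> goo.
have le_m u : (\esum_(k in [set: int])
    (`|g (u - k%:~R)| * `|u - k%:~R| `^ r)%:E <= moment r g)%E.
  by apply: ereal_sup_ubound; exists u.
have m0 : (0 <= moment r g)%E.
  apply: le_trans (le_m 0); apply: esum_ge0 => k _.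
  by rewrite lee_fin mulr_ge0// powR_ge0.
exists (fine (moment r g)); first exact: fine_ge0.
by move=> u; rewrite fineK ?ge0_fin_numE//; exact: le_m.
Qed.

Lemma moment0_bound g : (moment 0 g < +oo)%E -> exists2 M, 0 <= M &
  forall u, (\esum_(k in [set: int]) (`|g (u - k%:~R)|)%:E <= M%:E)%E.
Proof.
move=> /moment_bound[M M0 gM]; exists M => // u.
apply: le_trans (gM u); apply: le_esum => k _.
by rewrite powRr0 mulr1.
Qed.

Lemma esum_int_ge_term (a : int -> R) k : (forall k, 0 <= a k) ->
  ((a k)%:E <= \esum_(i in [set: int]) (a i)%:E)%E.
Proof.
move=> a0; rewrite -[leLHS](@esum_set1 R int k (fun i => (a i)%:E)) ?lee_fin//.
rewrite esum_mkcond; apply: le_esum => i _.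
by case: ifPn => // _; rewrite lee_fin.
Qed.

(** At distance at least [delta] from 0 the weight [|x|^r] is at least
    [delta^r], so those terms are controlled by the moment of order [r]; the
    others are bounded and at most [2 delta + 1] in number. *)
Lemma bounded_near0_moment_bound r g : 0 < r -> bounded_near g (nbhs (0 : R)) ->
  (moment r g < +oo)%E -> exists2 M, 0 <= M &
  forall u, (\esum_(k in [set: int]) (`|g (u - k%:~R)|)%:E <= M%:E)%E.
Proof.
move=> r0 gb /moment_bound[Mr Mr0 gM].
have [B [B0 nB]] : exists B, 0 <= B /\ \forall x \near (0 : R), `|g x| <= B.
  have [B [_ hB]] := gb.
  exists (`|B| + 1); split; first by rewrite addr_ge0.
  by apply: hB; rewrite (le_lt_trans (ler_norm B))// ltrDl.
have [delta /= delta0 hdl] := nB.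
have dr0 : 0 < delta `^ r by exact: powR_gt0.
exists (B * (2 * delta + 1) + (delta `^ r)^-1 * Mr).
  rewrite addr_ge0// mulr_ge0 ?invr_ge0 ?powR_ge0//.
  by rewrite addr_ge0// mulr_ge0// ltW.
move=> u.
apply: (@le_trans _ _ (B%:E * (\esum_(k in [set: int])
     ((u - delta < k%:~R <= u + delta)%R%:R)%:E) + (delta `^ r)^-1%:E *
   \esum_(k in [set: int]) (`|g (u - k%:~R)| * `|u - k%:~R| `^ r)%:E)%E); last first.
  rewrite EFinD (EFinM B) (EFinM (delta `^ r)^-1); apply: leeD; last first.
    by rewrite lee_wpmul2l ?lee_fin ?invr_ge0 ?powR_ge0.
  rewrite lee_wpmul2l ?lee_fin//.
  have lr : u - delta <= u + delta by lra.
  apply: (le_trans (esum_int_count lr)).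
  by rewrite lee_fin; lra.
rewrite -esumZl//.
have wt0 k : (0 <= (`|g (u - k%:~R)| * `|u - k%:~R| `^ r)%:E)%E.
  by rewrite lee_fin mulr_ge0// powR_ge0.
rewrite -esumZl ?invr_ge0 ?powR_ge0//.
rewrite -esumD; last 2 first.
- by move=> k _; rewrite -EFinM lee_fin mulr_ge0// ler0n.
- by move=> k _; rewrite -EFinM lee_fin mulr_ge0 ?invr_ge0 ?powR_ge0// mulr_ge0// powR_ge0.
apply: le_esum => k _; rewrite -!EFinM -EFinD lee_fin.
have [ukd|dku] := ltP `|u - k%:~R| delta.
  have -> : (u - delta < k%:~R <= u + delta).
    by move: ukd; rewrite ltr_norml => /andP[h1 h2]; apply/andP; split; lra.
  rewrite mulr1 (@le_trans _ _ B)//.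
    apply: hdl; rewrite /ball_/= sub0r normrN//.
  by rewrite lerDl mulr_ge0 ?invr_ge0 ?powR_ge0// mulr_ge0// powR_ge0.
apply: (@le_trans _ _ ((delta `^ r)^-1 * (`|g (u - k%:~R)| * `|u - k%:~R| `^ r))).
  rewrite mulrCA ler_peMr// mulrC ler_pdivlMr// mul1r.
  by apply: ge0_ler_powR; rewrite ?nnegrE ?(ltW r0) ?(ltW delta0).
by rewrite lerDr mulr_ge0// ler0n.
Qed.
End moments.

Lemma Lnorm_le d (T : measurableType d) (R : realType)
    (mu : {measure set T -> \bar R}) (p e : R) (g : T -> R) :
  0 < p -> 0 <= e ->
  (\int[mu]_x (`|g x| `^ p)%:E <= (e `^ p)%:E)%E ->
  ('N[mu]_(p%:E)[EFin \o g] <= e%:E)%E.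
Proof.
move=> p0 e0 ge.
rewrite unlock /=.
have -> : e%:E = ((e `^ p)%:E `^ p^-1)%E.
  by rewrite poweR_EFin -powRrM mulfV ?gt_eqF// powRr1.
apply: gt0_ler_poweR => //.
- by rewrite invr_ge0 ltW.
- rewrite in_itv/= leey andbT; apply: integral_ge0 => x _.
  by rewrite lee_fin powR_ge0.
- by rewrite in_itv/= leey andbT lee_fin powR_ge0.
Qed.

Theorem corollary6p2 (R : realType) (phi psi : R -> R)
    (hker : kernel_pair phi psi) (hpsi : (moment 0 psi < +oo)%E)
    (p : R) (hp : 1 <= p) (f : R -> R) (hf : f \in Lfun (leb R) p%:E) :
  (forall w : R, 0 < w -> durrmeyer_defined phi psi w f) /\
  ('N[leb R]_(p%:E)[EFin \o (durrmeyer phi psi w f \- f)%R])%E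
    @[w --> +oo%R] --> 0%E.
Proof.
pose T := lebT R; pose mu := lebm R.
have p0 : 0 < p by exact: lt_le_trans hp.
have [Lphi Lpsi bphi part intpsi1 [r r0 mphi]] := hker.
have [Mphi Mphi0 phiM] := bounded_near0_moment_bound r0 bphi mphi.
have [Mpsi Mpsi0 psiM] := moment0_bound hpsi.
have iphi : mu.-integrable [set: T] (EFin \o phi) by exact/Lfun1_integrable.
have ipsi : mu.-integrable [set: T] (EFin \o psi) by exact/Lfun1_integrable.
have ifp : mu.-integrable [set: T] (fun x => (`|f x| `^ p)%:E).
  exact: (Lfun_integrable hp hf).
have mf : measurable_fun [set: T] f.
  by move: hf; rewrite inE => /andP[/[!inE]].
have mmphi : measurable_fun [set: T] phi.
  by apply/measurable_EFinP; exact: measurable_int iphi.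
have mmpsi : measurable_fun [set: T] psi.
  by apply/measurable_EFinP; exact: measurable_int ipsi.
have norm_int (g : T -> R) : mu.-integrable [set: T] (EFin \o g) ->
    exists A, (\int[mu]_x (`|g x|)%:E <= A%:E)%E.
  move=> /integrableP[_ goo]; exists (fine (\int[mu]_x (`|g x|)%:E)%E).
  by rewrite fineK// ge0_fin_numE// integral_ge0.
have [Aphi phiA] := norm_int _ iphi.
have [Apsi psiA] := norm_int _ ipsi.
have foo : (\int[mu]_x (`|f x| `^ p)%:E < +oo)%E.
  have /integrableP[_] := ifp; apply: le_lt_trans.
  rewrite le_eqVlt; apply/orP; left; apply/eqP; apply: eq_integral => x _.
  by rewrite gee0_abs// lee_fin powR_ge0.
have psi_le (x : T) : `|psi x| <= Mpsi.
  rewrite -lee_fin (le_trans _ (psiM x))//.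
  have := @esum_int_ge_term R (fun k => `|psi (x - k%:~R)|) 0 (fun k => normr_ge0 _).
  by rewrite subr0.
have mnode w k : 0 < w -> measurable_fun [set: T] (node w k).
  exact: measurable_node.
split.
  move=> w w0.
  have mpre k : measurable_fun [set: T] (shrink w k) by exact: measurable_shrink.
  have nK k : cancel (node w k) (shrink w k) by exact: nodeK.
  have cov k (F : T -> \bar R) := @ge0_integral_node R w k F w0.
  split; first exact: (integrable_pre_mul w0 hp mpre nK cov mf ipsi psiA psi_le foo).
  exact: (is_cvg_sampling_series w0 hp mpre nK cov mf ipsi psiA
    (fun x : T => phiM (w * (x : R))) psi_le foo).
have psi1 : \int[mu]_x psi x = 1 by exact: intpsi1.
pose K := power_const p Mphi Apsi.
have K0 : 0 <= K by rewrite mulr_ge0// powR_ge0.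
have K1 : 0 < K + 1 by rewrite ltr_wpDl.
have bound w : 0 < w ->
    (\int[mu]_x (`|durrmeyer phi psi w f x - f x| `^ p)%:E <= K%:E *
      osc mu (@node R) p (fun x => (`|phi x|)%:E) (fun x => (`|psi x|)%:E) f w)%E.
  move=> w0.
  have mpre k : measurable_fun [set: T] (shrink w k) by exact: measurable_shrink.
  have nK k : cancel (node w k) (shrink w k) by exact: nodeK.
  have cov k (F : T -> \bar R) := @ge0_integral_node R w k F w0.
  exact: (integral_sampling_series_le w0 hp (mnode w ^~ w0) mpre nK cov mmphi mf ipsi psi1 psiA
    (fun x : T => phiM (w * (x : R))) (fun x : T => part (w * (x : R))) psi_le foo).
have small e : 0 < e -> \forall w \near +oo%R,
    ('N[mu]_(p%:E)[EFin \o (durrmeyer phi psi w f \- f)%R] <= e%:E)%E.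
  move=> e0; have ep0 : 0 < e `^ p / (K + 1) by rewrite divr_gt0// powR_gt0.
  have vf := vanishing_Lp hp (measurableT_comp (@normr_measurable R setT) mmphi)
    (fun x => normr_ge0 (phi x))
    (measurableT_comp (@normr_measurable R setT) mmpsi)
    (fun x => normr_ge0 (psi x)) phiA psiA phiM psiM mf foo ep0.
  apply: filterS2 (nbhs_pinfty_gt (num_real 0)) vf => w w0 ow.
  apply: (Lnorm_le p0 (ltW e0)).
  have := bound w w0; move=> /le_trans; apply.
  apply: (@le_trans _ _ (K%:E * (e `^ p / (K + 1))%:E)%E).
    by apply: lee_wpmul2l; [rewrite lee_fin|exact: ow].
  rewrite -EFinM lee_fin mulrCA ler_piMr ?powR_ge0//.
  by rewrite ler_pdivrMr// mul1r lerDl.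
apply/fine_cvgP; split.
  apply: filterS (small 1 ltr01) => w Nw.
  by rewrite ge0_fin_numE ?Lnorm_ge0// (le_lt_trans Nw)// ltry.
apply/cvgr0Pnorm_le => e e0; apply: filterS (small e e0) => w Nw /=.
have Nfin : 'N[mu]_(p%:E)[EFin \o (durrmeyer phi psi w f \- f)%R]%E \is a fin_num.
  by rewrite ge0_fin_numE ?Lnorm_ge0// (le_lt_trans Nw)// ltry.
by rewrite ger0_norm ?fine_ge0 ?Lnorm_ge0// -lee_fin fineK.
Qed.
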